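(* Let $W=\{\omega_1,\dots,\omega_r\}$ be a local integral basis at infinity of $A$, $\lambda\in\mathbb Z$ minimal such that $\Delta W=x^\lambda MW$ with $M\in C(x)_\infty^{r\times r}$, $k\ge0$ an integer, and $\psi_i:=x^{-k-\lambda-1}\Delta(x^{k+1}\omega_i)$. Assume $\lambda\ge-1$. Then for any $a_1,\dots,a_r\in C(x)_\infty$ the linear system $\sum_{i=1}^rx^{-\lambda-1}a_i\omega_i=\sum_{i=1}^r\sigma(b_i)\psi_i$ has a solution $(b_1,\dots,b_r)$ in $(C(x)_\infty/\langle x^{-\lambda-2}\rangle)^r$ (i.e. there exist $b_1,\dots,b_r\in C(x)_\infty$ satisfying it, whose residue classes modulo $x^{-\lambda-2}C(x)_\infty$ give the solution).
   Context: Let $C$ be a field of characteristic zero with algebraic closure $\bar C$; $\sigma(f)(x)=f(x+1)$, $C(x)[S]$ the Ore algebra with $Sf=\sigma(f)S$, $\Delta=S-1$. Fix $L=\sum_{i=0}^r\ell_iS^i\in C[x][S]$, $\ell_0\ell_r\ne0$, and $A=C(x)[S]/C(x)[S]L$. Let $R$ be the ring of finite $\bar C$-linear combinations of generalized series $x^{-s}\Gamma(x)^{u/v}\phi^x\exp(p(x^{1/v}))a(x^{-1/v},\log x)$ ($v\in\mathbb N\setminus\{0\}$, $u\in\mathbb Z$, $s\in\bar C$, $\phi\in\bar C\setminus\{0\}$, $a\in\bar C[[x]][y]$, $p\in\bar C[x]$, $\deg p<v$). Fix $\iota:\bar C\to\mathbb R$ with $\iota(s_1+s_2)\ge\iota(s_1)+\iota(s_2)$,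 $\iota(m+s)=\iota(m)+\iota(s)$, $\iota(m)=m$ for $m\in\mathbb Q$. The term $x^{-s}\Gamma(x)^{u/v}\phi^x\exp(p(x^{1/v}))\log(x)^\ell$ has valuation $\iota(s)$; a nonzero series has valuation $\nu_\infty$ equal to the minimum over its terms. $\sigma$ acts on $R$ by $x\mapsto x+1$ expanded as series, operators $\sum p_iS^i$ act by $\sum p_i\sigma^i(b)$. Fix a basis $b_1,\dots,b_r$ of the $r$-dimensional solution space $\operatorname{Sol}_\infty(L)\subseteq R$ consisting of series of this form; $\operatorname{val}_\infty(f)=\min_i\nu_\infty(f\cdot b_i)$; $f$ is integral at infinity if $\operatorname{val}_\infty(f)\ge0$. $C(x)_\infty=\{p/q:\deg p\le\deg q\}$; a local integral basis at infinity is a $C(x)_\infty$-basis of the module of elements of $A$ integral at infinity. *)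

(* Defs.v *)
From HB Require Import structures.
From mathcomp Require Import all_boot all_order all_algebra.
From mathcomp Require Import boolp classical_sets reals.

Set Implicit Arguments.
Unset Strict Implicit.
Unset Printing Implicit Defensive.

Import Order.TTheory GRing.Theory Num.Theory.
Local Open Scope ring_scope.

Section RatFun.
Variable C : fieldType.

Definition RF := {fraction {poly C}}.
Definition rfnum (f : RF) : {poly C} := (frac (repr f)).1.
Definition rfden (f : RF) : {poly C} := (frac (repr f)).2.
Definition rfpoly (p : {poly C}) : RF := FracField.tofrac p.
Definition rfX : RF := rfpoly 'X.
Definition rfsigma (f : RF) : RF :=
  rfpoly (rfnum f \Po ('X + 1)) / rfpoly (rfden f \Po ('X + 1)).
Definition rf_inf : pred RF := fun f => (size (rfnum f) <= size (rfden f))%N.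
End RatFun.

Section PS.
Variable K : fieldType.
Definition ps := nat -> K.
Definition ps1 : ps := fun n => (n == 0%N)%:R.
Definition psmul (a b : ps) : ps := fun n => \sum_(i < n.+1) a i * b (n - i)%N.
Definition pspow (a : ps) (k : nat) : ps := iter k (psmul a) ps1.
(* exp(a), for a(0) = 0 *)
Definition psexp (a : ps) : ps :=
  fun n => \sum_(k < n.+1) pspow a k n / (k`!)%:R.
Definition binser (al : K) : ps :=
  fun n => (\prod_(i < n) (al - i%:R)) / (n`!)%:R.
Definition logser : ps :=
  fun n => if n is m.+1 then (-1) ^+ m / (m.+1)%:R else 0.
Definition stretch (v : nat) (a : ps) : ps :=
  fun n => if (v %| n)%N then a (n %/ v)%N else 0.
(* a(z) |-> a(z * g(z)) *)
Definition pscompt (a g : ps) : ps :=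
  fun n => \sum_(j < n.+1) a j * pspow g j (n - j)%N.
(* 1/b, for b(0) != 0 *)
Definition psinv (b : ps) : ps :=
  fun n => (b 0%N)^-1 * \sum_(k < n.+1)
      pspow (fun i => if i is 0%N then 0 else - b i / b 0%N) k n.
End PS.

(* Expansion at infinity of a rational function:
   f = x^(rfexp_deg f) * h(1/x), h = rfexp_ser f a power series. *)
Section RFExp.
Variable C : fieldType.
Definition revc (p : {poly C}) : ps C :=
  fun i => if (i < size p)%N then p`_(size p - 1 - i) else 0.
Definition rfexp_deg (f : RF C) : int :=
  (size (rfnum f))%:Z - (size (rfden f))%:Z.
Definition rfexp_ser (f : RF C) : ps C :=
  psmul (revc (rfnum f)) (psinv (revc (rfden f))).
End RFExp.

(* Generalized series: one term                                         *)
(*   x^(-s) Gamma(x)^(u/v) phi^x exp(p(x^(1/v))) a(x^(-1/v), log x)     *)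
(* with v = gv.+1, a = sum_(j,l) ga j l * t^j * y^l  (t = x^(-1/v)).    *)
Section GSeries.
Variable K : fieldType.

Record gterm := GTerm {
  gv : nat; gu : int; gs : K; gphi : K; gp : {poly K}; gd : nat;
  ga : nat -> nat -> K }.

Definition vof (t : gterm) : nat := (gv t).+1.

Definition gterm_valid (t : gterm) : Prop :=
  [/\ gphi t != 0, (size (gp t) <= vof t)%N, (gp t)`_0 = 0
    & forall j l, (gd t < l)%N -> ga t j l = 0].

Definition gseries := seq gterm.
Definition gseries_valid (F : gseries) : Prop :=
  foldr (fun t P => gterm_valid t /\ P) True F.

Definition gscale (c : K) (t : gterm) : gterm :=
  GTerm (gv t) (gu t) (gs t) (gphi t) (gp t) (gd t) (fun j l => c * ga t j l).

(* multiplication by an expansion x^d * h(1/x) *)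
Definition gmulexp (d : int) (h : ps K) (t : gterm) : gterm :=
  GTerm (gv t) (gu t) (gs t - d%:~R) (gphi t) (gp t) (gd t)
        (fun j l => psmul (stretch (vof t) h) (fun j' => ga t j' l) j).

Definition gsigma (t : gterm) : gterm :=
  let v := vof t in
  let s := gs t in
  let F1 := stretch v (binser (- s)) in
  let D : ps K := fun n => \sum_(m < v)
      (gp t)`_m * (stretch v (binser ((m%:R : K) / v%:R)) (n + m)%N - ps1 K (n + m)%N) in
  let E := psexp D in
  let g := stretch v (binser (- (v%:R : K)^-1)) in
  let Lg := stretch v (logser K) in
  GTerm (gv t) (gu t) (s - (gu t)%:~R / v%:R) (gphi t) (gp t) (gd t)
    (fun j m => gphi t * psmul F1 (psmul E (fun n => \sum_(l < (gd t).+1)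
        'C(l, m)%:R * psmul (pscompt (fun j' => ga t j' l) g) (pspow Lg (l - m)) n)) j).

Definition gsigma_ser (F : gseries) : gseries := map gsigma F.

(* monomial keys x^(-s) Gamma^q phi^x exp(P) log^l, where P is the function
   rational exponent e |-> coefficient of x^e in the exponent polynomial *)
Record gkey := GKey { ks : K; kq : rat; kphi : K; kP : rat -> K; kl : nat }.

Definition Pfun (t : gterm) : rat -> K :=
  fun e => \sum_(m < vof t) if ((m%:R : rat) / (vof t)%:R == e) then (gp t)`_m else 0.

Definition term_coef (t : gterm) (k : gkey) : K :=
  if `[< exists j : nat, gs t + (j%:R / (vof t)%:R) = ks k >]
     && ((gu t)%:~R / (vof t)%:R == kq k) && (gphi t == kphi k)
     && `[< Pfun t =1 kP k >]
  then ga t (xget 0%N [set j : nat | gs t + (j%:R / (vof t)%:R) = ks k]) (kl k)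
  else 0.

Definition ser_coef (F : gseries) (k : gkey) : K := \sum_(t <- F) term_coef t k.
Definition ser_eq (F G : gseries) : Prop := forall k, ser_coef F k = ser_coef G k.
Definition ser_zero (F : gseries) : Prop := forall k, ser_coef F k = 0.

(* nu_infty(F) >= 0, where a monomial x^(-s)... has valuation iota(s) *)
Definition ser_integral (Rr : realType) (iv : K -> Rr) (F : gseries) : Prop :=
  forall k, ser_coef F k != 0 -> 0 <= iv (ks k).
End GSeries.

(* The module A = C(x)[S]/C(x)[S]L, coordinates on 1, S, ..., S^(r-1) *)
Section Amod.
Variables (C : fieldType) (K : fieldType) (iota0 : {rmorphism C -> K}).
Variables (r : nat) (l : nat -> {poly C}).

Definition gcoord (g : 'rV[RF C]_r) (n : nat) : RF C :=
  if @insub nat (fun k => (k < r)%N) 'I_r n is Some i then g 0 i else 0.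

(* left multiplication by S, reduced using S^r = - sum_j (l_j/l_r) S^j *)
Definition Ashift (g : 'rV[RF C]_r) : 'rV[RF C]_r :=
  \row_(i < r) ((if (i : nat) is i'.+1 then rfsigma (gcoord g i') else 0)
                - rfsigma (gcoord g r.-1) * rfpoly (l i) / rfpoly (l r)).

Definition Adelta (g : 'rV[RF C]_r) : 'rV[RF C]_r := Ashift g - g.

Definition rfmul (f : RF C) (t : gterm K) : gterm K :=
  gmulexp (rfexp_deg f) (fun n => iota0 (rfexp_ser f n)) t.

Definition Aact (g : 'rV[RF C]_r) (F : gseries K) : gseries K :=
  flatten [seq map (rfmul (g 0 i)) (iter i (@gsigma_ser K) F) | i <- enum 'I_r].

Definition Lact (F : gseries K) : gseries K :=
  flatten [seq map (rfmul (rfpoly (l j))) (iter j (@gsigma_ser K) F) | j <- iota 0 r.+1].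
End Amod.

(* Main.v *)
Require Import Defs.
From HB Require Import structures.
From mathcomp Require Import all_boot all_order all_algebra.
From mathcomp Require Import boolp classical_sets reals.
From mathcomp Require Import ring zify.
Import Order.TTheory GRing.Theory Num.Theory.
Local Open Scope ring_scope.

(** It suffices to show that if [sum_i c_i x^(-k) Delta(x^(k+1) w_i)] is integral,
    then every [c_i] lies in C(x)_oo: applied to x^n c this makes the matrix of the
    system invertible, and then it bounds the solution.
    Otherwise rescale so that the [c_i] lie in C(x)_oo and do not all vanish at
    infinity, while the combination has valuation at least 1.  Writing
    c_i = sigma(b_i), Delta(b_i) is O(x^(-2)), so f = sum_i b_i w_i satisfies
    val(x^(-k) Delta(x^(k+1) f)) >= 1 although val(f) < 1.  This is impossible,
    as one sees on the leading term x^(-s) log(x)^l of f applied to a solution: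
    unless the Gamma, phi^x or exponential factor makes Delta lose less than one
    order, Delta multiplies the leading term of x^(k+1) f by (k+1-s)/x, and
    iota(s) < 1 excludes s = k+1.

    All summands of f applied to a fixed solution share the factors
    Gamma(x)^(u/v) phi^x exp(p), so they are handled as coefficient families
    indexed by an integer exponent and a power of log.  Such families bounded below
    form a torsion-free C[x]-module, so the action of p/q is controlled by the
    relation q G = p F and no Laurent series product is needed. *)

Set Implicit Arguments.
Unset Strict Implicit.
Unset Printing Implicit Defensive.

(** * Formal power series *)

Definition fps (K : fieldType) := nat -> K.

Section PowerSeriesRing.
Variable K : fieldType.
Implicit Types a b c : fps K.

HB.instance Definition _ := gen_eqMixin (fps K).
HB.instance Definition _ := gen_choiceMixin (fps K).

Let fadd a b : fps K := fun n => a n + b n.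
Let fopp a : fps K := fun n => - a n.
Let fzero : fps K := fun=> 0.

Fact fps_addA : associative fadd.
Proof. by move=> a b c; apply/funext => n; rewrite /fadd addrA. Qed.
Fact fps_addC : commutative fadd.
Proof. by move=> a b; apply/funext => n; rewrite /fadd addrC. Qed.
Fact fps_add0 : left_id fzero fadd.
Proof. by move=> a; apply/funext => n; rewrite /fadd add0r. Qed.
Fact fps_addN : left_inverse fzero fopp fadd.
Proof. by move=> a; apply/funext => n; rewrite /fadd addNr. Qed.

HB.instance Definition _ :=
  GRing.isZmodule.Build (fps K) fps_addA fps_addC fps_add0 fps_addN.

Lemma fps_coefD a b n : (a + b) n = a n + b n. Proof. by []. Qed.
Lemma fps_coefB a b n : (a - b) n = a n - b n. Proof. by []. Qed.
Lemma fps_coef0 n : (0 : fps K) n = 0. Proof. by []. Qed.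
Lemma fps_coef_sum (I : Type) (r : seq I) (P : pred I) (F : I -> fps K) n :
  (\sum_(i <- r | P i) F i) n = \sum_(i <- r | P i) F i n.
Proof. by elim/big_rec2: _ => // i x y _ <-. Qed.

(** Below order [N] a product only sees the first [N] coefficients of its factors, so the ring
    axioms are inherited from polynomials. *)
Definition trunc N a : {poly K} := \poly_(i < N) a i.

Lemma psmul_trunc N a b n : (n < N)%N ->
  psmul a b n = (trunc N a * trunc N b)`_n.
Proof.
move=> nN; rewrite coefM; apply: eq_bigr => i _; rewrite !coef_poly.
by rewrite (leq_ltn_trans (leq_ord i) nN) (leq_ltn_trans (leq_subr _ _) nN).
Qed.

Lemma trunc_psmul N a b n : (n < N)%N ->
  (trunc N (psmul a b))`_n = (trunc N a * trunc N b)`_n.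
Proof. by move=> nN; rewrite coef_poly nN (psmul_trunc _ _ nN). Qed.

Fact psmulC : commutative (@psmul K).
Proof.
by move=> a b; apply/funext => n; rewrite !(psmul_trunc _ _ (ltnSn n)) mulrC.
Qed.

Fact psmulA : associative (@psmul K).
Proof.
move=> a b c; apply/funext => n; rewrite !(psmul_trunc _ _ (ltnSn n)).
transitivity ((trunc n.+1 a * trunc n.+1 b * trunc n.+1 c)`_n).
  rewrite -mulrA coefM [RHS]coefM; apply: eq_bigr => i _.
  by rewrite trunc_psmul // ltnS leq_subr.
by rewrite !coefM; apply: eq_bigr => i _; rewrite trunc_psmul // -coefM.
Qed.

Fact psmul1 : left_id (ps1 K) (@psmul K).
Proof.
move=> a; apply/funext => n; rewrite /psmul big_ord_recl /ps1 eqxx mul1r subn0.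
by rewrite big1 ?addr0 // => i _; rewrite mul0r.
Qed.

Fact psmulDl : left_distributive (@psmul K) fadd.
Proof.
move=> a b c; apply/funext => n; rewrite /psmul /fadd -big_split /=.
by apply: eq_bigr => i _; rewrite mulrDl.
Qed.

HB.instance Definition _ :=
  GRing.Zmodule_isComPzRing.Build (fps K) psmulA psmulC psmul1 psmulDl.

Lemma psmulE (a b : ps K) : psmul a b = (a : fps K) * (b : fps K).
Proof. by []. Qed.

Lemma fps_coefM a b n : (a * b) n = \sum_(i < n.+1) a i * b (n - i)%N.
Proof. by []. Qed.

Lemma fps_coef1 n : (1 : fps K) n = (n == 0%N)%:R. Proof. by []. Qed.

Lemma pspowE (a : ps K) k : pspow a k = (a : fps K) ^+ k.
Proof. by elim: k => // k IH; rewrite exprS -IH. Qed.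

Lemma fps_coef0M a b : (a * b) 0%N = a 0%N * b 0%N.
Proof. by rewrite fps_coefM big_ord1. Qed.

Definition fps_low N a := forall n, (n < N)%N -> a n = 0.

Lemma fps_low_mul M N a b : fps_low M a -> fps_low N b -> fps_low (M + N) (a * b).
Proof.
move=> ha hb n nMN; rewrite fps_coefM big1 // => i _.
have [iM|iM] := ltnP i M; first by rewrite ha ?mul0r.
by rewrite hb ?mulr0 //; move: (ltn_ord i) => ?; lia.
Qed.

Lemma fps_low_exp N a k : fps_low N a -> fps_low (N * k) (a ^+ k).
Proof.
move=> ha; elim: k => [|k IH]; first by rewrite muln0.
by rewrite exprS mulnS; apply: fps_low_mul.
Qed.

(** With [b = b(0) (1 - w)] and [w(0) = 0], [psinv b] is a geometric series in [w], whose
    coefficient [n] only involves [w^k] for [k <= n]. *)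
Lemma psinvP (b : ps K) : b 0%N != 0 -> psmul b (psinv b) = ps1 K.
Proof.
move=> b0; pose w : fps K := fun i => if i is 0%N then 0 else - b i / b 0%N.
have wlow : fps_low 1 w by case.
pose cst : fps K := fun n => b 0%N *+ (n == 0%N).
have bE : (b : fps K) = cst * (1 - w).
  apply/funext => n; rewrite fps_coefM big_ord_recl /= subn0 big1 ?addr0; last first.
    by move=> i _; rewrite /cst /= mul0r.
  rewrite fps_coefB /cst eqxx mulr1n fps_coef1.
  by case: n => [|n] /=; rewrite ?subr0 ?mulr1 ?sub0r // mulNr opprK mulrC divfK.
apply/funext => n.
(* One cutoff serves all coefficients up to [n], so the geometric sum telescopes; the remainder
   [w ^+ n.+1] has no coefficient of order [n]. *)
pose G : fps K := \sum_(k < n.+1) w ^+ k.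
have wk k m : (m < k)%N -> (w ^+ k) m = 0.
  by move=> mk; apply: (fps_low_exp (k := k) wlow); rewrite mul1n.
have invE m : (m <= n)%N -> psinv b m = (b 0%N)^-1 * G m.
  move=> mn; rewrite /psinv; congr (_ * _).
  under eq_bigr do rewrite pspowE.
  rewrite /G fps_coef_sum [RHS](bigID (fun k : 'I_n.+1 => (k < m.+1)%N)) /=.
  rewrite [X in _ + X]big1 ?addr0; last by move=> i; rewrite -leqNgt => /wk.
  by rewrite (big_ord_widen n.+1 (fun k => (w ^+ k) m)).
have -> : psmul b (psinv b) n = (b 0%N)^-1 * ((b : fps K) * G) n.
  rewrite fps_coefM mulr_sumr; apply: eq_bigr => i _.
  by rewrite invE ?leq_subr // mulrCA.
have -> : (b : fps K) * G = cst * (1 - w ^+ n.+1).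
  by rewrite bE -mulrA; congr (_ * _); rewrite -[1 in RHS](expr1n _ n.+1) subrXX
     /G; congr (_ * _); apply: eq_bigr => i _; rewrite expr1n mul1r.
rewrite fps_coefM big_ord_recl big1 ?addr0 => [|i _]; last by rewrite /cst mul0r.
by rewrite /cst eqxx mulr1n subn0 fps_coefB wk // subr0 mulKf.
Qed.

Definition fps_deriv a : fps K := fun n => n.+1%:R * a n.+1.

Lemma fps_derivM a b : fps_deriv (a * b) = fps_deriv a * b + a * fps_deriv b.
Proof.
apply/funext => n; rewrite /fps_deriv fps_coefD !fps_coefM.
have -> : n.+1%:R * (\sum_(i < n.+2) a i * b (n.+1 - i)%N) =
  \sum_(i < n.+2) (i%:R * a i * b (n.+1 - i)%N)
  + \sum_(i < n.+2) (a i * ((n.+1 - i)%N%:R * b (n.+1 - i)%N)).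
  rewrite mulr_sumr -big_split /=; apply: eq_bigr => i _.
  rewrite natrB; last by rewrite -ltnS ltn_ord.
  by ring.
congr (_ + _).
  by rewrite big_ord_recl /= !mul0r add0r; apply: eq_bigr => i _.
rewrite big_ord_recr /= subnn mul0r mulr0 addr0.
by apply: eq_bigr => i _; rewrite subSn // -ltnS ltn_ord.
Qed.

Section Char0.
Hypothesis char0 : forall n, n.+1%:R != 0 :> K.

Lemma binser0 (al : K) : binser al 0%N = 1.
Proof. by rewrite /binser big_ord0 fact0 divr1. Qed.

Lemma fact_neq0 n : (n`!)%:R != 0 :> K.
Proof. by rewrite -(prednK (fact_gt0 n)). Qed.

Lemma binserS (al : K) n : n.+1%:R * binser al n.+1 = (al - n%:R) * binser al n.
Proof.
rewrite /binser big_ord_recr factS natrM /=.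
by field; rewrite fact_neq0 -?mulrSr ?char0 //= addrC natr1.
Qed.

(** In characteristic zero the recurrence determines every coefficient from the constant one. *)
Lemma binser_uniq (al : K) a : a 0%N = 1 ->
  (forall n, n.+1%:R * a n.+1 = (al - n%:R) * a n) -> a = binser al.
Proof.
move=> a0 aS; apply/funext; elim=> [|n IH]; first by rewrite a0 binser0.
by apply: (mulfI (char0 n)); rewrite aS binserS IH.
Qed.

Definition fpsX : fps K := fun n => (n == 1%N)%:R.

Lemma fps_coefXM a n : (fpsX * a) n = if n is m.+1 then a m else 0.
Proof.
rewrite fps_coefM; case: n => [|n].
  by rewrite big_ord1 mul0r.
rewrite big_ord_recl mul0r add0r big_ord_recl mul1r big1 ?addr0 ?subSS ?subn0 //.
by move=> i _; rewrite mul0r.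
Qed.

Definition fpsC (al : K) : fps K := fun n => al *+ (n == 0%N).

Lemma fps_coefCM (al : K) a n : (fpsC al * a) n = al * a n.
Proof.
rewrite fps_coefM big_ord_recl big1 ?addr0 => [|i _]; rewrite /fpsC /= ?mul0r //.
by rewrite mulr1n subn0.
Qed.

Lemma fps_coefXnM k a n : (fpsX ^+ k * a) n = if (k <= n)%N then a (n - k)%N else 0.
Proof.
elim: k n => [|k IH] n; first by rewrite mul1r subn0.
by rewrite exprS -mulrA fps_coefXM; case: n => // n; rewrite IH subSS.
Qed.

(* The series binser al is characterised by (1 + z) B' = al B. *)
Lemma binserP (al : K) a :
  (1 + fpsX) * fps_deriv a = fpsC al * a <->
  (forall n, n.+1%:R * a n.+1 = (al - n%:R) * a n).
Proof.
have E n : ((1 + fpsX) * fps_deriv a) n = n.+1%:R * a n.+1 + n%:R * a n.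
  by rewrite mulrDl mul1r fps_coefD fps_coefXM; case: n => [|n]; rewrite ?mul0r.
split=> [/(congr1 (fun f : fps K => f _)) h n | h].
  have := h n; rewrite E fps_coefCM mulrBl => <-; ring.
by apply/funext => n; rewrite E fps_coefCM h; ring.
Qed.

(** By the Leibniz rule the product satisfies the differential equation of [(1 + z)^(al + be)]. *)
Lemma binserM (al be : K) : (binser al : fps K) * binser be = binser (al + be).
Proof.
apply: binser_uniq; first by rewrite fps_coef0M !binser0 mulr1.
apply/binserP; rewrite fps_derivM mulrDr mulrA mulrCA.
have /binserP -> := binserS al; have /binserP -> := binserS be.
have -> : fpsC (al + be) = fpsC al + fpsC be.
  by apply/funext => n; rewrite /fpsC fps_coefD mulrnDl.
by ring.
Qed.

Lemma binser_1 : (binser 1 : fps K) = 1 + fpsX.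
Proof.
symmetry; apply: binser_uniq; first by rewrite fps_coefD addr0.
case=> [|[|n]]; rewrite !fps_coefD !fps_coef1 /fpsX /= ?subr0 ?subrr ?mul0r //.
all: by rewrite ?addr0 ?add0r ?mulr0 ?mulr1 ?mul1r.
Qed.

Lemma binserX (al : K) k : (binser al : fps K) ^+ k = binser (al *+ k).
Proof.
elim: k => [|k IH]; last by rewrite exprS IH binserM mulrS.
rewrite expr0 mulr0n; apply: binser_uniq => // -[|n]; rewrite !fps_coef1 /= ?subrr ?mul0r ?mulr0 //.
Qed.

End Char0.

(** * The substitution of z^v for z *)

Section Stretch.
Variable v : nat.
Hypothesis v_gt0 : (0 < v)%N.

Lemma stretchM a b : (stretch v (a * b) : fps K) = (stretch v a : fps K) * stretch v b.
Proof.
apply/funext => n; rewrite fps_coefM.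
rewrite (bigID (fun i : 'I_n.+1 => (v %| i)%N)) /= [X in _ + X]big1 ?addr0; last first.
  by move=> i /negPf vi; rewrite /stretch vi mul0r.
rewrite {1}/stretch; case: ifPn => [/dvdnP[q ->]|nv]; last first.
  rewrite big1 // => i vi; rewrite /stretch vi dvdn_subl ?(negPf nv) ?mulr0 //.
  by rewrite -ltnS ltn_ord.
rewrite mulnK // fps_coefM.
rewrite (reindex_onto (fun i : 'I_q.+1 => inord (i * v) : 'I_(q * v).+1)
  (fun i => inord (i %/ v))) /=; last first.
  move=> i vi; apply: val_inj; rewrite /= inordK; last first.
    by rewrite inordK ?divnK // ltnS leq_divLR // -ltnS ltn_ord.
  by rewrite inordK ?divnK // ltnS leq_divLR // -ltnS ltn_ord.
have iv (i : 'I_q.+1) : (i * v < (q * v).+1)%N by rewrite ltnS leq_mul2r -ltnS ltn_ord orbT.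
apply: eq_big => [i|i _].
  rewrite inordK ?iv // dvdn_mull // mulnK //=; symmetry.
  by apply/eqP/val_inj; rewrite /= inordK.
by rewrite inordK ?iv // /stretch dvdn_mull // mulnK // -mulnBl dvdn_mull // mulnK.
Qed.

Lemma stretch1 : (stretch v (ps1 K) : fps K) = 1.
Proof.
apply/funext => n; rewrite /stretch /ps1 fps_coef1.
case: ifP => [/dvdnP[q ->]|]; last by case: n => [|n]; rewrite ?dvdn0.
by rewrite mulnK // muln_eq0 (gtn_eqF v_gt0) orbF.
Qed.

Lemma stretchX a k : (stretch v (a ^+ k) : fps K) = (stretch v a : fps K) ^+ k.
Proof. by elim: k => [|k IH]; rewrite ?stretch1 // !exprS stretchM IH. Qed.

Lemma stretchD a b : (stretch v (a + b) : fps K) = (stretch v a : fps K) + stretch v b.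
Proof. by apply/funext=> n; rewrite fps_coefD /stretch; case: ifP; rewrite ?addr0. Qed.

Lemma stretch_fpsX : (stretch v fpsX : fps K) = fpsX ^+ v.
Proof.
apply/funext => n; rewrite -[fpsX ^+ v]mulr1 fps_coefXnM fps_coef1 /stretch /fpsX.
case: ifPn => [/dvdnP[q ->]|nv].
  rewrite mulnK //; case: q => [|[|q]]; first by rewrite mul0n leqn0 (gtn_eqF v_gt0).
    by rewrite mul1n leqnn subnn.
  rewrite leq_pmull // -[X in (_ - X)%N]mul1n -mulnBl muln_eq0 (gtn_eqF v_gt0) orbF.
  by rewrite subSS subn0.
case: ifP => // vn; case: eqP => // /eqP; rewrite subn_eq0 => nv'.
have nE : n = v by apply/eqP; rewrite eqn_leq nv' vn.
by rewrite nE dvdnn in nv.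
Qed.

Lemma stretch_low a n : (0 < n < v)%N -> stretch v a n = 0.
Proof. by case/andP=> n0 nv; rewrite /stretch gtnNdvd. Qed.

Lemma stretch_at0 a : stretch v a 0%N = a 0%N.
Proof. by rewrite /stretch dvdn0 div0n. Qed.

Lemma stretch_at1 a : stretch v a v = a 1%N.
Proof. by rewrite /stretch dvdnn divnn v_gt0. Qed.
End Stretch.

(** [pscompt a g] is the sum of all [a_j z^j g^j]; only [j <= n] reach coefficient [n], so the sum
    may be cut before multiplying by [c]. *)
Lemma pscomptM (a g c : fps K) n :
  ((pscompt a g : fps K) * c) n = \sum_(j < n.+1) a j * (g ^+ j * c) (n - j)%N.
Proof.
have -> : ((pscompt a g : fps K) * c) n =
    ((\sum_(j < n.+1) fpsC (a j) * (fpsX ^+ j * g ^+ j)) * c) n.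
  rewrite !fps_coefM; apply: eq_bigr => i _; congr (_ * _).
  rewrite fps_coef_sum (bigID (fun j : 'I_n.+1 => (j < i.+1)%N)) /=.
  rewrite [X in _ = _ + X]big1 ?addr0; last first.
    move=> j; rewrite -leqNgt ltnNge => ij.
    by rewrite fps_coefCM fps_coefXnM leqNgt ltnNge (negPf ij) mulr0.
  rewrite /pscompt (big_ord_widen n.+1 (fun j => a j * pspow g j (i - j)%N)) //.
  by apply: eq_bigr => j ji; rewrite fps_coefCM fps_coefXnM -ltnS ji pspowE.
rewrite mulr_suml fps_coef_sum; apply: eq_bigr => j _.
by rewrite -!mulrA fps_coefCM fps_coefXnM -ltnS ltn_ord.
Qed.

End PowerSeriesRing.

(** * Coefficient families bounded below *)

(* [F l n] is the coefficient of x^(-s - n/v) log(x)^l, where s, v and the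
   Gamma, phi^x and exponential factors are fixed. *)
Definition gvec (K : fieldType) := nat -> int -> K.

Section GvecZmod.
Variable K : fieldType.
Implicit Types F G H : gvec K.

HB.instance Definition _ := gen_eqMixin (gvec K).
HB.instance Definition _ := gen_choiceMixin (gvec K).

Let gadd F G : gvec K := fun l n => F l n + G l n.
Let gopp F : gvec K := fun l n => - F l n.
Let gzero : gvec K := fun _ _ => 0.

Fact gvec_addA : associative gadd.
Proof. by move=> F G H; apply/funext => l; apply/funext => n; rewrite /gadd addrA. Qed.
Fact gvec_addC : commutative gadd.
Proof. by move=> F G; apply/funext => l; apply/funext => n; rewrite /gadd addrC. Qed.
Fact gvec_add0 : left_id gzero gadd.
Proof. by move=> F; apply/funext => l; apply/funext => n; rewrite /gadd add0r. Qed.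
Fact gvec_addN : left_inverse gzero gopp gadd.
Proof. by move=> F; apply/funext => l; apply/funext => n; rewrite /gadd addNr. Qed.

HB.instance Definition _ :=
  GRing.isZmodule.Build (gvec K) gvec_addA gvec_addC gvec_add0 gvec_addN.

Lemma gvecD F G l n : (F + G) l n = F l n + G l n. Proof. by []. Qed.
Lemma gvecN F l n : (- F) l n = - F l n. Proof. by []. Qed.
Lemma gvecB F G l n : (F - G) l n = F l n - G l n. Proof. by []. Qed.
Lemma gvec0 l n : (0 : gvec K) l n = 0. Proof. by []. Qed.
Lemma gvec_sum (I : Type) (r : seq I) (P : pred I) (F : I -> gvec K) l n :
  (\sum_(i <- r | P i) F i) l n = \sum_(i <- r | P i) F i l n.
Proof. by elim/big_rec2: _ => // i x y _ <-. Qed.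

Definition bounded_at (N : int) F := forall l n, n < N -> F l n = 0.
Definition bounded F := exists N, bounded_at N F.

Lemma bounded_atW M N F : M <= N -> bounded_at N F -> bounded_at M F.
Proof. by move=> MN bF l n nM; apply: bF; apply: lt_le_trans MN. Qed.

Lemma bounded_add F G : bounded F -> bounded G -> bounded (F + G).
Proof.
move=> [M bF] [N bG]; exists (Num.min M N) => l n.
by rewrite lt_min => /andP[nM nN]; rewrite gvecD bF ?bG ?addr0.
Qed.

Lemma bounded_opp F : bounded F -> bounded (- F).
Proof. by move=> [M bF]; exists M => l n nM; rewrite gvecN bF ?oppr0. Qed.

Lemma bounded_sum (I : Type) (r : seq I) (P : pred I) (F : I -> gvec K) :
  (forall i, bounded (F i)) -> bounded (\sum_(i <- r | P i) F i).
Proof.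
move=> bF; elim/big_rec: _ => [|i G _]; first by exists 0.
exact: bounded_add.
Qed.

(** Orders are integers bounded below, so a least one occurs. The arguments on leading terms start
    from this [n0]. *)
Lemma bounded_min F l n : bounded F -> F l n != 0 ->
  exists n0 l0, [/\ n0 <= n, F l0 n0 != 0 & bounded_at n0 F].
Proof.
move=> [N bF] Fn.
pose P k := `[< exists l, F l (N + k%:Z) != 0 >].
have Nle l' n' : F l' n' != 0 -> N <= n' by apply: contraR; rewrite -ltNge => /bF ->.
have PF l' n' : F l' n' != 0 -> P `|n' - N|%N.
  move=> F'; apply/asboolP; exists l'.
  by rewrite (_ : N + _ = n') //; have := Nle _ _ F'; lia.
have exP : exists k, P k by exists `|n - N|%N; apply: PF Fn.
case: (ex_minnP exP) => k /asboolP[l0 Fk] kmin.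
have kle l' n' : F l' n' != 0 -> N + k%:Z <= n'.
  by move=> F'; have := kmin _ (PF _ _ F'); have := Nle _ _ F'; lia.
exists (N + k%:Z), l0; split => //; first exact: kle Fn.
move=> l' n' n'k; apply/eqP; apply: contraTT n'k => F'; rewrite -leNgt.
exact: kle F'.
Qed.

End GvecZmod.

(** * The C[x]-module of families bounded below *)

Section PolyAction.
Variables (C K : fieldType) (iota0 : {rmorphism C -> K}) (v : nat).
Implicit Types (p q : {poly C}) (F G : gvec K).

Definition xshift F : gvec K := fun l n => F l (n + v%:Z).

(* the action of p(x), where x raises exponents: x^(-s-(n+v)/v) * x = x^(-s-n/v) *)
Definition pact p F : gvec K :=
  fun l n => \sum_(i < size p) iota0 p`_i * F l (n + (v * i)%:Z).

Lemma pact_widen N p F l n : (size p <= N)%N ->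
  pact p F l n = \sum_(i < N) iota0 p`_i * F l (n + (v * i)%:Z).
Proof.
move=> pN; rewrite /pact (big_ord_widen N (fun i => iota0 p`_i * F l (n + (v * i)%:Z))) //.
rewrite [RHS](bigID (fun i : 'I_N => (i < size p)%N)) /= [X in _ + X]big1 ?addr0 //.
by move=> i; rewrite -leqNgt => ip; rewrite nth_default // rmorph0 mul0r.
Qed.

Lemma pactDl p q F : pact (p + q) F = pact p F + pact q F.
Proof.
apply/funext => l; apply/funext => n; rewrite gvecD.
pose N := maxn (size p) (size q).
rewrite !(@pact_widen N) ?leq_maxl ?leq_maxr ?size_polyD // -big_split /=.
by apply: eq_bigr => i _; rewrite coefD rmorphD mulrDl.
Qed.

Lemma pactNl p F : pact (- p) F = - pact p F.
Proof.
apply/funext => l; apply/funext => n; rewrite gvecN /pact size_polyN -sumrN.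
by apply: eq_bigr => i _; rewrite coefN rmorphN mulNr.
Qed.

Lemma pactBl p q F : pact (p - q) F = pact p F - pact q F.
Proof. by rewrite pactDl pactNl. Qed.

Lemma pact0l F : pact 0 F = 0.
Proof. by apply/funext => l; apply/funext => n; rewrite /pact size_poly0 big_ord0. Qed.

Lemma pactDr p F G : pact p (F + G) = pact p F + pact p G.
Proof.
apply/funext => l; apply/funext => n; rewrite gvecD /pact -big_split /=.
by apply: eq_bigr => i _; rewrite gvecD mulrDr.
Qed.

Lemma pactNr p F : pact p (- F) = - pact p F.
Proof.
apply/funext => l; apply/funext => n; rewrite gvecN /pact -sumrN /=.
by apply: eq_bigr => i _; rewrite gvecN mulrN.
Qed.

Lemma pactBr p F G : pact p (F - G) = pact p F - pact p G.
Proof. by rewrite pactDr pactNr. Qed.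

Lemma pact0r p : pact p 0 = 0.
Proof.
by apply/funext => l; apply/funext => n; rewrite /pact big1 // => i _; rewrite mulr0.
Qed.

Lemma pact_sumr (I : Type) (r : seq I) (P : pred I) (F : I -> gvec K) p :
  pact p (\sum_(i <- r | P i) F i) = \sum_(i <- r | P i) pact p (F i).
Proof. by elim/big_rec2: _ => [|i x y _ <-]; rewrite ?pact0r ?pactDr. Qed.

Lemma pactC c F l n : pact c%:P F l n = iota0 c * F l n.
Proof.
by rewrite (@pact_widen 1) ?size_polyC_leq1 // big_ord1 coefC eqxx muln0 addr0.
Qed.

Lemma pact1 F : pact 1 F = F.
Proof. by apply/funext => l; apply/funext => n; rewrite pactC rmorph1 mul1r. Qed.

Lemma pactMX p F : pact (p * 'X) F = pact p (xshift F).
Proof.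
apply/funext => l; apply/funext => n.
have sz : (size (p * 'X)%R <= (size p).+1)%N.
  by rewrite (leq_trans (size_polyMleq _ _)) // size_polyX addn2.
rewrite (pact_widen _ _ _ sz) big_ord_recl coefMX /= rmorph0 mul0r add0r.
apply: eq_bigr => i _; rewrite coefMX /bump leq0n add1n /= mulnS /xshift; congr (_ * F l _); lia.
Qed.

Lemma pact_xshift p F : pact p (xshift F) = xshift (pact p F).
Proof.
apply/funext => l; apply/funext => n; apply: eq_bigr => i _.
by rewrite /xshift addrAC.
Qed.

Lemma pactXn k F l n : pact 'X^k F l n = F l (n + (v * k)%:Z).
Proof.
elim: k F => [|k IH] F; first by rewrite pact1 muln0 addr0.
by rewrite exprSr pactMX IH /xshift mulnS; congr (F l _); lia.
Qed.

Lemma pactM p q F : pact (p * q) F = pact p (pact q F).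
Proof.
elim/poly_ind: p F => [|p c IH] F; first by rewrite mul0r !pact0l.
rewrite mulrDl !pactDl mulrAC !pactMX IH pact_xshift; congr (_ + _).
apply/funext => l; apply/funext => n; rewrite pactC mul_polyC.
rewrite (@pact_widen (size q)) ?size_scale_leq // /pact mulr_sumr.
by apply: eq_bigr => i _; rewrite coefZ rmorphM mulrA.
Qed.

Lemma bounded_pact p F : bounded F -> bounded (pact p F).
Proof.
move=> [N bF]; exists (N - (v * size p)%:Z) => l n nN.
rewrite /pact big1 // => i _; rewrite bF ?mulr0 //.
have : (v * i <= v * size p)%N by rewrite leq_mul2l (ltnW (ltn_ord i)) orbT.
lia.
Qed.

Hypothesis v_gt0 : (0 < v)%N.

(** Each factor [x] lowers the index by [v]; at this index all coefficients of [p] but the top one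
    meet [F] below [n], where it vanishes. *)
Lemma pact_lead p F n l : bounded_at n F ->
  pact p F l (n - (v * (size p).-1)%:Z) = iota0 (lead_coef p) * F l n.
Proof.
move=> bF; rewrite lead_coefE; case: (posnP (size p)) => [p0|p0].
  by rewrite /pact p0 big_ord0 nth_default ?p0 // rmorph0 mul0r.
rewrite (@pact_widen (size p).-1.+1) ?leqSpred // big_ord_recr /= subrK.
rewrite big1 ?add0r // => i _; rewrite bF ?mulr0 //.
have : (v * i < v * (size p).-1)%N by rewrite ltn_mul2l v_gt0 ltn_ord.
by move: (v * i)%N (v * _.-1)%N => A B h; clear -h; lia.
Qed.

Lemma pact_inj0 p F : p != 0 -> bounded F -> pact p F = 0 -> F = 0.
Proof.
move=> p0 bF pF0; apply/funext => l; apply/funext => n; apply/eqP.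
apply/negPn/negP => /(bounded_min bF)[n0 [l0 [_ Fn0 /(pact_lead p) h]]].
move: (h l0); rewrite pF0 gvec0 => /esym/eqP.
by rewrite mulf_eq0 (negPf Fn0) orbF fmorph_eq0 lead_coef_eq0 (negPf p0).
Qed.

(** The cancellation law behind the identities for rational functions: both sides are multiplied by
    a common denominator and compared as polynomial actions. *)
Lemma pact_inj p F G : p != 0 -> bounded F -> bounded G ->
  pact p F = pact p G -> F = G.
Proof.
move=> p0 bF bG e; apply/eqP; rewrite -subr_eq0; apply/eqP.
apply: (pact_inj0 p0); first exact/bounded_add/bounded_opp.
by rewrite pactBr e subrr.
Qed.

(** The family of a single term whose expansion begins at index [o]; [a] takes its arguments in the
    order of [ga], opposite to [gvec]. *)
Definition lau (o : int) (a : nat -> nat -> K) : gvec K :=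
  fun l n => if o <= n then a `|n - o|%N l else 0.

Lemma bounded_lau o a : bounded (lau o a).
Proof. by exists o => l n no; rewrite /lau leNgt no. Qed.

Lemma stretch_sum (h : fps K) J : (forall j, (J <= j)%N -> h j = 0) ->
  (stretch v h : fps K) = \sum_(j < J) fpsC (h j) * (fpsX K) ^+ (v * j).
Proof.
move=> hJ; apply/funext => n; rewrite fps_coef_sum.
under eq_bigr do rewrite fps_coefCM -[_ ^+ _]mulr1 fps_coefXnM fps_coef1.
have E (j : 'I_J) : (if (v * j <= n)%N then ((n - v * j)%N == 0%N)%:R else 0) =
    (n == (v * j)%N)%:R :> K.
  by rewrite subn_eq0 eqn_leq; case: (v * j <= n)%N; rewrite ?andbT ?andbF.
under eq_bigr do rewrite E.
rewrite /stretch; case: ifPn => [/dvdnP[q ->]|nv]; last first.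
  by rewrite big1 // => j _; case: eqP => [nE|]; rewrite ?mulr0 //; rewrite nE dvdn_mulr in nv.
have Q (j : 'I_J) : ((q * v)%N == (v * j)%N) = (q == j).
  by rewrite mulnC eqn_pmul2l.
under eq_bigr do rewrite Q.
rewrite mulnK //; have [qJ|Jq] := ltnP q J.
  rewrite (bigD1 (Ordinal qJ)) //= eqxx mulr1 big1 ?addr0 // => i iq.
  by rewrite (_ : (q == i) = false) ?mulr0 //; apply/eqP => e; case/eqP: iq; apply: val_inj.
rewrite hJ // big1 // => i _; rewrite (_ : (q == i) = false) ?mulr0 //.
by apply/eqP => e; move: (ltn_ord i); rewrite -e ltnNge Jq.
Qed.

Definition revcK p : fps K := fun n => iota0 (revc p n).

(** Write [p = x^(deg p) h(1/x)], where [revc p] lists the coefficients of [h]: the power moves the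
    start by [v deg p], and [h] becomes a series in [t^v] with [t = x^(-1/v)]. *)
Lemma pact_lau p o a :
  pact p (lau o a) = lau (o - v%:Z * ((size p)%:Z - 1))
    (fun j l => ((stretch v (revcK p) : fps K) * (a^~ l : fps K)) j).
Proof.
apply/funext => l; apply/funext => n; rewrite /lau.
have revJ j : (size p <= j)%N -> revcK p j = 0.
  by move=> pj; rewrite /revcK /revc ltnNge pj rmorph0.
rewrite (stretch_sum revJ).
case: ifPn => [on|no]; last first.
  rewrite /pact big1 // => i _; case: ifPn => [on|]; rewrite ?mulr0 //.
  by case/negP: no; have ip := ltn_ord i; clear -ip on; nia.
set m := `|_|%N; rewrite mulr_suml fps_coef_sum /pact (reindex_inj rev_ord_inj) /=.
apply: eq_bigr => i _; have ip := ltn_ord i.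
rewrite -mulrA fps_coefCM fps_coefXnM /revcK /revc ip -subnDA add1n; congr (_ * _).
have mE : n + (v * (size p - i.+1))%:Z - o = m%:Z - (v * i)%:Z.
  have -> : m%:Z = n - (o - v%:Z * ((size p)%:Z - 1)).
    by rewrite /m gez0_abs ?subr_ge0.
  by rewrite !PoszM -subzn // -[i.+1]addn1 PoszD; ring.
move: (v * _)%N (v * i)%N m mE => A B m mE; clear -mE.
have -> : (o <= n + A%:Z) = (B <= m)%N by apply/idP/idP; lia.
by case: ifP => // Bm; congr (a _ l); lia.
Qed.

End PolyAction.

(** * The shift on coefficient families *)

Section Shift.
Variables (C K : fieldType) (iota0 : {rmorphism C -> K}).
Hypothesis char0 : forall n, n.+1%:R != 0 :> K.
Variable t0 : gterm K.
Local Notation v := (vof t0).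
Local Notation u := (gu t0).
Local Notation s0 := (gs t0).
Local Notation phi := (gphi t0).
Local Notation d := (gd t0).
Implicit Types (F G : gvec K) (p : {poly C}).

Lemma v_neq0 : v%:R != 0 :> K. Proof. exact: char0. Qed.
Hint Resolve v_neq0 : core.

Lemma intr_eq0_char0 (m : int) : (m%:~R == 0 :> K) = (m == 0).
Proof.
case: m => [[|m]|m]; first by rewrite eqxx.
  by apply/negbTE/char0.
by rewrite NegzE rmorphN oppr_eq0 /=; apply/negbTE/char0.
Qed.

Definition expo (n : int) : K := s0 + n%:~R / v%:R.

Lemma expo_inj : injective expo.
Proof.
move=> m n /addrI /(mulIf (invr_neq0 v_neq0)) /eqP.
by rewrite -subr_eq0 -rmorphB intr_eq0_char0 subr_eq0 => /eqP.
Qed.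

Definition expdiff : fps K := fun n => \sum_(m < v)
  (gp t0)`_m * (stretch v (binser ((m%:R : K) / v%:R)) (n + m)%N - ps1 K (n + m)%N).

(* (x+1)^(-s) exp(p((x+1)^(1/v)) - p(x^(1/v))) (log(x+1) - log x)^k, divided by
   x^(-s), as a series in x^(-1/v), where s = expo n. *)
Definition shiftker (n : int) (k : nat) : fps K :=
  (stretch v (binser (- expo n)) : fps K) * psexp expdiff
  * (stretch v (logser K) : fps K) ^+ k.

(** [Gamma(x+1)^(u/v) = x^(u/v) Gamma(x)^(u/v)] moves index [n + u] to [n]; the binomials expand
    [(log x + log(1 + 1/x))^l]. The cutoff [I] keeps the sum over earlier indices finite. *)
Definition shift_upto (I : nat) F : gvec K := fun m n =>
  phi * \sum_(l < d.+1) 'C(l, m)%:R *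
    \sum_(i < I) F l (n + u - i%:Z) * shiftker (n + u - i%:Z) (l - m) i.

Definition low_bound F : int := xget 0 [set N | bounded_at N F].

(* The substitution x |-> x + 1; a junk value unless F is bounded below. *)
Definition gshift F : gvec K := fun m n =>
  shift_upto (absz (n + u - low_bound F)%R).+1 F m n.

Lemma shift_upto_stable N I J F m n : bounded_at N F ->
  n + u - N < I%:Z -> (I <= J)%N -> shift_upto J F m n = shift_upto I F m n.
Proof.
move=> bF nI IJ; rewrite /shift_upto; congr (_ * _); apply: eq_bigr => l _.
congr (_ * _).
rewrite [RHS](big_ord_widen J
  (fun i : nat => F l (n + u - i%:Z) * shiftker (n + u - i%:Z) (l - m) i)) //.
rewrite [LHS](bigID (fun i : 'I_J => (i < I)%N)) /= [X in _ + X]big1 ?addr0 //.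
by move=> i; rewrite -leqNgt => Ii; rewrite bF ?mul0r //; lia.
Qed.

(** Summands with [n + u - i < N] vanish, so any lower bound and any large enough cutoff give the
    same value. *)
Lemma gshiftE N I F m n : bounded_at N F -> n + u - N < I%:Z ->
  gshift F m n = shift_upto I F m n.
Proof.
move=> bF nI; rewrite /gshift.
have bL : bounded_at (low_bound F) F by apply: (@xgetPex _ 0 [set N | bounded_at N F]); exists N.
set J := (absz _).+1; have nJ : n + u - low_bound F < J%:Z by rewrite /J; lia.
have [IJ|/ltnW JI] := leqP I J; first exact: shift_upto_stable bF nI IJ.
by rewrite (shift_upto_stable m bL nJ JI).
Qed.

Lemma bounded_gshift_at N F : bounded_at N F -> bounded_at (N - u) (gshift F).
Proof.
move=> bF m n nN; rewrite (@gshiftE N 0) //; last by lia.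
by rewrite /shift_upto big1 ?mulr0 // => l _; rewrite big_ord0 mulr0.
Qed.

Lemma bounded_gshift F : bounded F -> bounded (gshift F).
Proof. by move=> [N bF]; exists (N - u); apply: bounded_gshift_at. Qed.

Lemma shift_uptoD I F G m n :
  shift_upto I (F + G) m n = shift_upto I F m n + shift_upto I G m n.
Proof.
rewrite /shift_upto -mulrDr -big_split /=; congr (_ * _); apply: eq_bigr => l _.
rewrite -mulrDr -big_split /=; congr (_ * _); apply: eq_bigr => i _.
by rewrite gvecD mulrDl.
Qed.

Lemma gshiftD F G : bounded F -> bounded G -> gshift (F + G) = gshift F + gshift G.
Proof.
move=> [M bF] [N bG]; apply/funext => m; apply/funext => n.
pose L := Num.min M N.
have bF' : bounded_at L F by apply: bounded_atW bF; rewrite ge_min lexx.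
have bG' : bounded_at L G by apply: bounded_atW bG; rewrite ge_min lexx orbT.
have bFG : bounded_at L (F + G) by move=> l n' h; rewrite gvecD bF' ?bG' ?addr0.
have hI : n + u - L < (absz (n + u - L)%R).+1%:Z by lia.
by rewrite gvecD !(gshiftE _ _ hI) // shift_uptoD.
Qed.

Lemma gshift0 : gshift 0 = 0.
Proof.
have b0 : bounded (0 : gvec K) by exists 0.
by apply: (addrI (gshift 0)); rewrite -gshiftD // !addr0.
Qed.

Lemma gshift_sum (I : Type) (r : seq I) (P : pred I) (F : I -> gvec K) :
  (forall i, bounded (F i)) ->
  gshift (\sum_(i <- r | P i) F i) = \sum_(i <- r | P i) gshift (F i).
Proof.
move=> bF; elim: r => [|i r IH]; first by rewrite !big_nil gshift0.
by rewrite !big_cons; case: ifP => // _; rewrite gshiftD ?IH //; apply: bounded_sum.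
Qed.

(** Index [n - v] stands for one more factor [x], and [x + 1 = x (1 + t^v)] with [t = x^(-1/v)]. *)
Lemma shiftker_xshift n k :
  shiftker (n - v%:Z) k = shiftker n k * (1 + (fpsX K) ^+ v).
Proof.
rewrite /shiftker.
have -> : - expo (n - v%:Z) = - expo n + 1.
  by rewrite /expo rmorphB mulrBl /= -pmulrn divff // opprD opprB; ring.
rewrite -(binserM char0) (stretchM (ltn0Sn _)) (binser_1 char0) stretchD stretch1 //.
by rewrite stretch_fpsX //; ring.
Qed.

(** This is [sigma(x F) = (x + 1) sigma(F)]: in [1 + t^v], the summand 1 yields [x sigma(F)] and
    [t^v] yields [sigma(F)]. *)
Lemma gshift_xshift F : bounded F ->
  gshift (xshift v F) = xshift v (gshift F) + gshift F.
Proof.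
move=> [N bF]; apply/funext => m; apply/funext => n.
rewrite gvecD -[xshift v (gshift F) m n]/(gshift F m (n + v%:Z)).
pose I := (absz (n + u - N)%R).+1.
have bS : bounded_at (N - v%:Z) (xshift v F).
  by move=> l n' h; rewrite /xshift bF //; lia.
(* The cutoff [v + I] leaves exactly [I] summands once the factor [t^v] has removed the first
   [v]. *)
rewrite (@gshiftE _ (v + I) _ m n bS); last by rewrite /I; lia.
rewrite (@gshiftE _ (v + I) _ m (n + v%:Z) bF); last by rewrite /I; lia.
rewrite (@gshiftE _ I _ m n bF); last by rewrite /I; lia.
rewrite /shift_upto -mulrDr -big_split /=; congr (_ * _); apply: eq_bigr => l _ /=.
rewrite -mulrDr; congr (_ * _).
transitivity (\sum_(i < v + I) (F l (n + v%:Z + u - i%:Z) *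
     shiftker (n + v%:Z + u - i%:Z) (l - m) i +
   F l (n + v%:Z + u - i%:Z) *
     (fpsX K ^+ v * shiftker (n + v%:Z + u - i%:Z) (l - m)) i)).
  apply: eq_bigr => i _; rewrite /xshift.
  have -> : n + u - i%:Z + v%:Z = n + v%:Z + u - i%:Z by ring.
  have -> : n + u - i%:Z = n + v%:Z + u - i%:Z - v%:Z by ring.
  by rewrite shiftker_xshift mulrDr mulr1 fps_coefD [_ * fpsX K ^+ v]mulrC mulrDr.
rewrite big_split /=; congr (_ + _).
rewrite big_split_ord /= big1 ?add0r => [|i _]; last first.
  by rewrite fps_coefXnM leqNgt ltn_ord mulr0.
apply: eq_bigr => i _; rewrite fps_coefXnM leq_addr addKn.
by have -> : n + v%:Z + u - (v + i)%N%:Z = n + u - i%:Z by rewrite PoszD; ring.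
Qed.

Lemma gshift_pactC c F : bounded F ->
  gshift (pact iota0 v c%:P F) = pact iota0 v c%:P (gshift F).
Proof.
move=> [N bF]; apply/funext => m; apply/funext => n; rewrite pactC.
have bc : bounded_at N (pact iota0 v c%:P F).
  by move=> l n' h; rewrite pactC bF ?mulr0.
have hI : n + u - N < (absz (n + u - N)%R).+1%:Z by lia.
rewrite !(gshiftE _ _ hI) // /shift_upto mulrCA; congr (_ * _).
rewrite mulr_sumr; apply: eq_bigr => l _; rewrite mulrCA; congr (_ * _).
by rewrite mulr_sumr; apply: eq_bigr => i _; rewrite pactC mulrA.
Qed.

Lemma bounded_xshift F : bounded F -> bounded (xshift v F).
Proof. by move=> [N bF]; exists (N - v%:Z) => l n h; rewrite /xshift bF //; lia. Qed.

Lemma gshift_pact p F : bounded F ->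
  gshift (pact iota0 v p F) = pact iota0 v (p \Po ('X + 1)) (gshift F).
Proof.
elim/poly_ind: p F => [|p c IH] F bF; first by rewrite comp_poly0 !pact0l gshift0.
have bx := bounded_xshift bF.
rewrite pactDl gshiftD; [|exact: bounded_pact..].
rewrite gshift_pactC // pactMX IH // gshift_xshift //.
rewrite comp_polyD comp_polyM comp_polyX comp_polyC pactDl; congr (_ + _).
by rewrite mulrDr mulr1 pactDl pactMX pactDr.
Qed.

(* all summands of [Aact f [:: t0]] have this form *)
Definition fam_term (o : int) (a : nat -> nat -> K) : gterm K :=
  GTerm (gv t0) u (expo o) phi (gp t0) d a.

Definition fam_key (l : nat) (n : int) : gkey K :=
  GKey (expo n) (u%:~R / v%:R) phi (Pfun t0) l.

Lemma fam_term0 : t0 = fam_term 0 (ga t0).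
Proof. by rewrite /fam_term /expo mul0r addr0; case: t0. Qed.

Lemma expoD o (j : nat) : expo o + j%:R / v%:R = expo (o + j%:Z).
Proof. by rewrite /expo rmorphD /= -pmulrn mulrDl addrA. Qed.

(** The index that [term_coef] picks is unique, because [expo] is injective in characteristic
    zero. *)
Lemma term_coef_fam o a l n : term_coef (fam_term o a) (fam_key l n) = lau o a l n.
Proof.
rewrite /term_coef /= !eqxx !andbT /lau -[vof (fam_term o a)]/v.
have -> : `[< Pfun (fam_term o a) =1 Pfun t0 >] = true by apply/asboolP.
rewrite andbT.
case: asboolP => [[j]|no].
  rewrite expoD => /expo_inj jE.
  have -> : o <= n by lia.
  congr (a _ l); case: xgetP => [k _ /=|/(_ j)/=]; last by rewrite expoD jE.
  by rewrite expoD => /expo_inj; lia.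
case: ifPn => // on; case: no; exists `|n - o|%N; rewrite expoD; congr expo; lia.
Qed.

(** This reduces statements about all keys to integer-indexed families. *)
Lemma term_coef_fam_key o a k : term_coef (fam_term o a) k != 0 ->
  exists n, k = fam_key (kl k) n.
Proof.
rewrite /term_coef /=; case: ifP; rewrite ?eqxx //.
case/andP => /andP[/andP[/asboolP[j hs] /eqP hq] /eqP hphi] /asboolP hP _.
exists (o + j%:Z); rewrite /fam_key -expoD hs -[vof t0]/(vof (fam_term o a)) hq hphi.
have -> : Pfun t0 = kP k by apply/funext => e; rewrite -hP.
by case: k {hs hq hphi hP}.
Qed.

Lemma gsigma_fam o a : exists2 a', gsigma (fam_term o a) = fam_term (o - u) a' &
  lau (o - u) a' = gshift (lau o a) /\
  forall j m, (d < m)%N -> a' j m = 0.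
Proof.
eexists.
  rewrite /gsigma /fam_term /=; congr (GTerm _ _ _ _ _ _ _).
  by rewrite /expo rmorphB mulrBl /= addrA.
split; last first.
  move=> j m dm /=; rewrite [X in psmul _ X](_ : _ = (0 : fps K)); last first.
    rewrite [X in psmul _ X](_ : _ = (0 : fps K)) ?psmulE ?mulr0 //.
    apply/funext => n; rewrite big1 // => l _; rewrite bin_small ?mul0r //.
    by rewrite (leq_trans (ltn_ord l)).
  by rewrite psmulE mulr0 fps_coef0 mulr0.
apply/funext => m; apply/funext => n.
have bF : bounded_at o (lau o a) by move=> l n' h; rewrite /lau leNgt h.
rewrite [LHS]/lau; case: ifPn => [on|no]; last first.
  by rewrite (bounded_gshift_at bF) // ltNge.
set j := absz _; have jE : n + u = o + j%:Z by rewrite /j; lia.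
rewrite (@gshiftE o j.+1) //; last by rewrite jE; lia.
rewrite /shift_upto; congr (_ * _).
rewrite !psmulE -[vof (fam_term o a)]/v /= -/expdiff.
have -> : (fun n0 => \sum_(l < d.+1) 'C(l, m)%:R * psmul (pscompt (a^~ l)
     (stretch v (binser (- v%:R^-1)))) (pspow (stretch v (logser K)) (l - m)) n0) =
   \sum_(l < d.+1) fpsC 'C(l, m)%:R * ((pscompt (a^~ l)
     (stretch v (binser (- v%:R^-1))) : fps K) *
     (stretch v (logser K) : fps K) ^+ (l - m)) :> fps K.
  apply/funext => n0; rewrite fps_coef_sum; apply: eq_bigr => l _.
  by rewrite fps_coefCM pspowE.
rewrite mulrA mulr_sumr fps_coef_sum; apply: eq_bigr => l _.
rewrite mulrCA fps_coefCM; congr (_ * _).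
rewrite mulrCA pscomptM (reindex_inj rev_ord_inj) /=.
apply: eq_bigr => i _; have ij : (i <= j)%N by rewrite -ltnS ltn_ord.
rewrite subSS subKn // jE /lau.
have -> : o + j%:Z - i%:Z = o + (j - i)%N%:Z by lia.
rewrite lerDl lez_nat leq0n [o + _]addrC addrK absz_nat [_ + o]addrC; congr (_ * _).
rewrite /shiftker !mulrA; congr ((_ * _ * _ : fps K) i).
(* Substituting in [t^(j - i)] produces [(1 + 1/x)^(-(j - i)/v)], which merges with
   [(1 + 1/x)^(- expo o)] into the binomial series at [- expo (o + (j - i))]. *)
rewrite -stretchX // (binserX char0) -stretchM // (binserM char0); congr (stretch _ (binser _)).
by rewrite -expoD -mulr_natl; ring.
Qed.

End Shift.

(** * Rational functions *)

Section RationalFunctions.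
Variable C : fieldType.
Implicit Types (f g : RF C) (p q : {poly C}).
Local Notation tau := ('X + 1 : {poly C}).

Lemma rfden_neq0 f : rfden f != 0. Proof. exact: denom_ratioP. Qed.

Lemma rfpoly_eq0 p : (rfpoly p == 0) = (p == 0). Proof. exact: tofrac_eq0. Qed.
Lemma rfpolyD p q : rfpoly (p + q) = rfpoly p + rfpoly q. Proof. exact: tofracD. Qed.
Lemma rfpolyB p q : rfpoly (p - q) = rfpoly p - rfpoly q. Proof. exact: tofracB. Qed.
Lemma rfpolyM p q : rfpoly (p * q) = rfpoly p * rfpoly q. Proof. exact: tofracM. Qed.
Lemma rfpolyXn p n : rfpoly (p ^+ n) = rfpoly p ^+ n. Proof. exact: tofracXn. Qed.
Lemma rfpoly1 : rfpoly 1 = 1 :> RF C. Proof. exact: tofrac1. Qed.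
Lemma rfpoly0 : rfpoly 0 = 0 :> RF C. Proof. exact: tofrac0. Qed.
Lemma rfpoly_inj : injective (@rfpoly C).
Proof. by move=> p q /eqP; rewrite tofrac_eq => /eqP. Qed.

Lemma rfE f : f = rfpoly (rfnum f) / rfpoly (rfden f).
Proof.
have d0 : rfpoly (rfden f) != 0 by rewrite rfpoly_eq0 rfden_neq0.
apply: (mulIf d0); rewrite divfK // {d0} /rfden /rfnum; move: (reprK f).
case: (repr f) => -[n d] /= dn0 <-; rewrite /rfpoly !piE; apply/eqmodP => /=.
rewrite FracField.equivfE /FracField.mulf /= !numden_Ratio ?mulr1 ?oner_neq0 //=.
by rewrite mulrC.
Qed.

Lemma rffracP f : exists p q, q != 0 /\ f = rfpoly p / rfpoly q.
Proof. by exists (rfnum f), (rfden f); split; [exact: rfden_neq0 | exact: rfE]. Qed.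

Lemma rffrac_eq p q p' q' : q != 0 -> q' != 0 ->
  rfpoly p / rfpoly q = rfpoly p' / rfpoly q' :> RF C -> p * q' = p' * q.
Proof.
move=> q0 q0' /eqP; rewrite eqr_div ?rfpoly_eq0 // -!rfpolyM => /eqP.
exact: rfpoly_inj.
Qed.

Lemma size_tau : size tau = 2. Proof. by rewrite -polyC1 size_XaddC. Qed.

Lemma comp_tau_eq0 p : (p \Po tau == 0) = (p == 0).
Proof. by rewrite comp_poly2_eq0 ?size_tau. Qed.

Lemma size_comp_tau p : size (p \Po tau) = size p.
Proof. by rewrite size_comp_poly2 ?size_tau. Qed.

(** [rfsigma] uses a chosen representative; substituting in the cross-multiplied equality shows that
    every representative gives the same value. *)
Lemma rfsigma_frac p q : q != 0 ->
  rfsigma (rfpoly p / rfpoly q) = rfpoly (p \Po tau) / rfpoly (q \Po tau).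
Proof.
move=> q0; rewrite /rfsigma; set f := (X in rfnum X).
have e := rffrac_eq (rfden_neq0 f) q0 (esym (rfE f)).
apply/eqP; rewrite eqr_div ?rfpoly_eq0 ?comp_tau_eq0 ?rfden_neq0 //.
by rewrite -!rfpolyM -!comp_polyM e.
Qed.

Lemma rfsigma_poly p : rfsigma (rfpoly p) = rfpoly (p \Po tau).
Proof.
rewrite -[rfpoly p]divr1 -rfpoly1 rfsigma_frac ?oner_neq0 //.
by rewrite comp_polyC rfpoly1 divr1.
Qed.

Lemma rfsigmaM f g : rfsigma (f * g) = rfsigma f * rfsigma g.
Proof.
have [p [q [q0 ->]]] := rffracP f; have [p' [q' [q0' ->]]] := rffracP g.
by rewrite mulf_div -!rfpolyM !rfsigma_frac ?mulf_neq0 // !comp_polyM !rfpolyM mulf_div.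
Qed.

Lemma rfsigmaD f g : rfsigma (f + g) = rfsigma f + rfsigma g.
Proof.
have [p [q [q0 ->]]] := rffracP f; have [p' [q' [q0' ->]]] := rffracP g.
rewrite addf_div ?rfpoly_eq0 // -!rfpolyM -rfpolyD !rfsigma_frac ?mulf_neq0 //.
by rewrite comp_polyD !comp_polyM rfpolyD !rfpolyM addf_div ?rfpoly_eq0 ?comp_tau_eq0.
Qed.

Lemma rfsigma_surj g : exists f, rfsigma f = g.
Proof.
have [p [q [q0 ->]]] := rffracP g.
have K (r : {poly C}) : (r \Po ('X - 1)) \Po tau = r.
  by rewrite -comp_polyA comp_polyB comp_polyX comp_polyC addrK comp_polyXr.
exists (rfpoly (p \Po ('X - 1)) / rfpoly (q \Po ('X - 1))).
rewrite rfsigma_frac ?K //.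
by rewrite comp_poly2_eq0 // -polyC1 size_XsubC.
Qed.

(** Comparing degrees in the cross-multiplied equality shows that the choice of representative does
    not matter. *)
Lemma rf_inf_frac p q : q != 0 ->
  (rfpoly p / rfpoly q \in @rf_inf C) = (size p <= size q)%N.
Proof.
move=> q0; rewrite unfold_in; set f := rfpoly p / _.
have e := rffrac_eq (rfden_neq0 f) q0 (esym (rfE f)).
have [p0|p0] := eqVneq p 0.
  move/eqP: e; rewrite p0 mul0r mulf_eq0 (negPf q0) orbF => /eqP ->.
  by rewrite size_poly0 !leq0n.
have n0 : rfnum f != 0.
  apply: contraNneq p0 => n0; move/eqP: e; rewrite n0 mul0r eq_sym mulf_eq0.
  by rewrite (negPf (rfden_neq0 f)) orbF.
move/(congr1 (fun p : {poly C} => size p)): e.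
rewrite !size_mul ?rfden_neq0 //.
have := size_poly_eq0 q; rewrite (negPf q0).
have := size_poly_eq0 (rfden f); rewrite (negPf (rfden_neq0 f)).
have := size_poly_eq0 p; rewrite (negPf p0).
have := size_poly_eq0 (rfnum f); rewrite (negPf n0).
move: (size p) (size q) (size (rfnum f)) (size (rfden f)) => a b c d.
by move=> ? ? ? ? ?; apply/idP/idP; lia.
Qed.

Lemma rf_infM f g : f \in @rf_inf C -> g \in @rf_inf C -> f * g \in @rf_inf C.
Proof.
have [p [q [q0 ->]]] := rffracP f; have [p' [q' [q0' ->]]] := rffracP g.
rewrite mulf_div -!rfpolyM !rf_inf_frac ?mulf_neq0 // => pq pq'.
rewrite (leq_trans (size_polyMleq _ _)) // size_mul //.
move: (size p) (size q) (size p') (size q') pq pq' => a b c d; lia.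
Qed.

Lemma rf_inf0 : 0 \in @rf_inf C.
Proof. by rewrite -[0](mul0r (rfpoly 1)^-1) -rfpoly0 rf_inf_frac ?oner_neq0 // size_poly0. Qed.

Lemma rf_infX n m : ((rfX C) ^+ n / (rfX C) ^+ m \in @rf_inf C) = (n <= m)%N.
Proof.
by rewrite -!rfpolyXn rf_inf_frac -?size_poly_eq0 ?size_polyXn // ltnS.
Qed.

Lemma rf_inf_exprN n : (rfX C) ^- n \in @rf_inf C.
Proof. by rewrite -[_ ^- _]mul1r -[1](expr0 (rfX C)) rf_infX. Qed.

Lemma rf_inf_sigma f : (rfsigma f \in @rf_inf C) = (f \in @rf_inf C).
Proof.
have [p [q [q0 ->]]] := rffracP f.
by rewrite rfsigma_frac // !rf_inf_frac ?comp_tau_eq0 // !size_comp_tau.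
Qed.

Lemma rfX_neq0 : rfX C != 0. Proof. by rewrite rfpoly_eq0 polyX_eq0. Qed.

Lemma rfsigmaX : rfsigma (rfX C) = rfX C + 1.
Proof. by rewrite rfsigma_poly comp_polyX rfpolyD rfpoly1. Qed.

Lemma rf_inf_exprN_mul f : exists n, forall m, (n <= m)%N -> (rfX C) ^- m * f \in @rf_inf C.
Proof.
have [p [q [q0 ->]]] := rffracP f; exists (size p) => m pm.
have -> : (rfX C) ^- m * (rfpoly p / rfpoly q) = rfpoly p / rfpoly ('X^m * q).
  by rewrite rfpolyM rfpolyXn invfM mulrCA.
have Xm0 : 'X^m != 0 :> {poly C} by rewrite -size_poly_eq0 size_polyXn.
rewrite rf_inf_frac ?mulf_neq0 // size_mul // size_polyXn.
have : (0 < size q)%N by rewrite size_poly_gt0.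
by move: (size p) (size q) pm => a b; lia.
Qed.

(** For [f = p/q] with [p != 0], the exponent [size q] already gives a numerator of larger degree
    than [q]. *)
Lemma rf_inf_expr_eq0 f : (forall n, (rfX C) ^+ n * f \in @rf_inf C) -> f = 0.
Proof.
have [p [q [q0 ->]]] := rffracP f => h.
have [->|p0] := eqVneq p 0; first by rewrite rfpoly0 mul0r.
have := h (size q); rewrite mulrA -rfpolyXn -rfpolyM rf_inf_frac //.
have Xm0 : 'X^(size q) != 0 :> {poly C} by rewrite -size_poly_eq0 size_polyXn.
have : (0 < size p)%N by rewrite size_poly_gt0.
by rewrite size_mul // size_polyXn; move: (size p) (size q) => a b; lia.
Qed.

Lemma size_comp_tau_sub p : (size (p \Po tau - p)%R <= (size p).-1)%N.
Proof.
have [->|p0] := eqVneq p 0; first by rewrite comp_poly0 subr0 size_poly0.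
apply/leq_sizeP => j; rewrite leq_eqVlt coefB => /predU1P[<-|pj].
  have := lead_coef_comp p (q := tau); rewrite size_tau => /(_ isT).
  rewrite -polyC1 lead_coefXaddC expr1n mulr1 polyC1 !lead_coefE size_comp_tau.
  by move->; rewrite subrr.
have {}pj : (size p <= j)%N by move: pj; case: (size p).
by rewrite !nth_default ?size_comp_tau // subrr.
Qed.

(* Removing the constant term at infinity leaves a numerator of smaller degree,
   and each of the two shift differences lowers the degree once more. *)
Lemma rf_inf_delta f : f \in @rf_inf C ->
  (rfX C) ^+ 2 * (rfsigma f - f) \in @rf_inf C.
Proof.
have [p [q [q0 ->]]] := rffracP f; rewrite rf_inf_frac // => pq.
have q'0 : q \Po tau != 0 by rewrite comp_tau_eq0.
pose c := p`_(size q).-1 / lead_coef q; pose p' : {poly C} := p - c *: q.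
have lq0 : lead_coef q != 0 by rewrite lead_coef_eq0.
have sp' : (size p' <= (size q).-1)%N.
  apply/leq_sizeP => j; rewrite leq_eqVlt coefB coefZ => /predU1P[<-|qj].
    by rewrite -lead_coefE divfK ?subrr.
  have {}qj : (size q <= j)%N by move: qj; case: (size q).
  by rewrite !nth_default // ?mulr0 ?subr0 // (leq_trans pq).
pose N : {poly C} := (p' \Po tau - p') * q - p' * (q \Po tau - q).
have -> : rfsigma (rfpoly p / rfpoly q) - rfpoly p / rfpoly q =
   rfpoly N / rfpoly ((q \Po tau) * q).
  rewrite rfsigma_frac // -mulNr addf_div ?rfpoly_eq0 //.
  rewrite mulNr -!rfpolyM -rfpolyB; congr (rfpoly _ / _).
  by rewrite /N /p' comp_polyB comp_polyZ -!mul_polyC; ring.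
have sA : (size ((p' \Po tau - p') * q)%R <= ((size q).-1).*2.-1)%N.
  have [p'0|p'0] := eqVneq p' 0; first by rewrite p'0 comp_poly0 subr0 mul0r size_poly0.
  rewrite (leq_trans (size_polyMleq _ _)) //.
  have := size_comp_tau_sub p'; have : (0 < size p')%N by rewrite size_poly_gt0.
  by move: (size p') (size q) (size _) sp' => a b c'; lia.
have sB : (size (p' * (q \Po tau - q))%R <= ((size q).-1).*2.-1)%N.
  have [p'0|p'0] := eqVneq p' 0; first by rewrite p'0 mul0r size_poly0.
  rewrite (leq_trans (size_polyMleq _ _)) //.
  have := size_comp_tau_sub q; have : (0 < size p')%N by rewrite size_poly_gt0.
  by move: (size p') (size q) (size _) sp' => a b c'; lia.
have sN : (size N <= (size q).-1.*2.-1)%N.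
  by rewrite (leq_trans (size_polyD _ _)) // geq_max sA size_polyN.
have [N0|N0] := eqVneq N 0; first by rewrite N0 rfpoly0 mul0r mulr0 rf_inf0.
rewrite mulrA -rfpolyXn -rfpolyM rf_inf_frac ?mulf_neq0 //.
rewrite (leq_trans (size_polyMleq _ _)) // size_polyXn size_mul // size_comp_tau.
move: N0 sN; rewrite -size_poly_gt0; move: (size N) (size q) => a b; lia.
Qed.

End RationalFunctions.

(** * The action on a solution *)

Section Action.
Variables (C K : fieldType) (iota0 : {rmorphism C -> K}).
Hypothesis char0 : forall n, n.+1%:R != 0 :> K.
Variable t0 : gterm K.
Hypothesis t0_valid : gterm_valid t0.
Local Notation v := (vof t0).
Local Notation d := (gd t0).
Local Notation pact := (pact iota0 v).
Implicit Types (f : RF C) (p q : {poly C}).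

Definition log_bounded (F : gvec K) := forall l n, (d < l)%N -> F l n = 0.

Definition in_family (t : gterm K) := exists o a, t = fam_term t0 o a /\
  forall j l, (d < l)%N -> a j l = 0.

Definition tvec (t : gterm K) : gvec K := fun l n => term_coef t (fam_key t0 l n).

Lemma tvec_fam o a : tvec (fam_term t0 o a) = lau o a.
Proof. by apply/funext => l; apply/funext => n; apply: term_coef_fam. Qed.

Lemma bounded_tvec t : in_family t -> bounded (tvec t).
Proof. by move=> [o [a [-> _]]]; rewrite tvec_fam; apply: bounded_lau. Qed.

Lemma log_bounded_tvec t : in_family t -> log_bounded (tvec t).
Proof.
move=> [o [a [-> ha]]] l n dl; rewrite tvec_fam /lau.
by case: ifP => // _; rewrite ha.
Qed.

Lemma in_family_t0 : in_family t0.
Proof. by exists 0, (ga t0); split; [apply: fam_term0 | case: t0_valid]. Qed.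

Lemma in_family_gsigma t : in_family t ->
  in_family (gsigma t) /\ tvec (gsigma t) = gshift t0 (tvec t).
Proof.
move=> [o [a [-> _]]]; have [a' -> [e h]] := gsigma_fam char0 t0 o a.
by split; [exists (o - gu t0), a' | rewrite !tvec_fam e].
Qed.

Lemma iota_psmul (a b : fps C) :
  (fun n => iota0 (psmul a b n)) = ((fun n => iota0 (a n)) : fps K) * (fun n => iota0 (b n)).
Proof.
apply/funext => n; rewrite fps_coefM rmorph_sum.
by apply: eq_bigr => i _; rewrite rmorphM.
Qed.

(** Since [psinv] inverts, the expansion [h] satisfies [revc (rfden f) * h = revc (rfnum f)], and
    [rfexp_deg] accounts for the starting indices. *)
Lemma rfmul_fam f t : in_family t -> in_family (rfmul iota0 f t) /\
  pact (rfden f) (tvec (rfmul iota0 f t)) = pact (rfnum f) (tvec t).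
Proof.
move=> [o [a [-> ha]]].
pose h : fps K := fun n => iota0 (rfexp_ser f n).
pose a' j l := ((stretch v h : fps K) * (a^~ l : fps K)) j.
have E : rfmul iota0 f (fam_term t0 o a) = fam_term t0 (o - v%:Z * rfexp_deg f) a'.
  rewrite /rfmul /gmulexp /fam_term /=; congr (GTerm _ _ _ _ _ _ _).
  move: (rfexp_deg f) => e; rewrite /expo rmorphB /= intrM mulrBl -pmulrn.
  by field; exact: v_neq0.
split.
  rewrite E; exists (o - v%:Z * rfexp_deg f), a'; split=> // j l dl.
  by rewrite /a' fps_coefM big1 // => i _; rewrite ha ?mulr0.
rewrite E !tvec_fam !pact_lau //.
have -> : o - v%:Z * rfexp_deg f - v%:Z * ((size (rfden f))%:Z - 1) =
          o - v%:Z * ((size (rfnum f))%:Z - 1).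
  by rewrite /rfexp_deg; ring.
congr lau; apply/funext => j; apply/funext => l; rewrite /a'.
suff -> : (stretch v (revcK iota0 (rfnum f)) : fps K) =
          (stretch v (revcK iota0 (rfden f)) : fps K) * (stretch v h : fps K).
  by rewrite -mulrA.
rewrite -stretchM //; congr stretch.
rewrite /h /rfexp_ser iota_psmul -/(revcK iota0 (rfnum f)) mulrCA -/(revcK iota0 (rfnum f)).
rewrite -(iota_psmul (revc (rfden f))) psinvP; last first.
  rewrite /revc size_poly_gt0 rfden_neq0 subn0 subn1 -lead_coefE.
  by rewrite lead_coef_eq0 rfden_neq0.
rewrite (_ : (fun n => iota0 (ps1 C n)) = (1 : fps K)) ?mulr1 //.
by apply/funext => n; rewrite fps_coef1 /ps1 rmorph_nat.
Qed.

Lemma rfmul_frac f t p q : in_family t -> q != 0 -> rfpoly q * f = rfpoly p ->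
  pact q (tvec (rfmul iota0 f t)) = pact p (tvec t).
Proof.
move=> ft q0 qf; have [fr e] := rfmul_fam f ft.
have d0 := rfden_neq0 f.
have pq : p * rfden f = rfnum f * q.
  apply: (@rffrac_eq C p q (rfnum f) (rfden f)) => //.
  by rewrite -rfE -qf mulrC mulKf // rfpoly_eq0.
apply: (pact_inj (iota0 := iota0) (ltn0Sn _ : 0 < v)%N d0);
  try exact/bounded_pact/bounded_tvec.
by rewrite -pactM [rfden f * q]mulrC pactM e -!pactM [rfden f * p]mulrC pq [q * _]mulrC.
Qed.

Definition iter_sigma i := iter i (@gsigma K) t0.
Definition svec i := tvec (iter_sigma i).

Lemma in_family_iter i : in_family (iter_sigma i).
Proof.
by elim: i => [|i IH]; [exact: in_family_t0 | case: (in_family_gsigma IH)].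
Qed.

Lemma bounded_svec i : bounded (svec i).
Proof. exact/bounded_tvec/in_family_iter. Qed.

Lemma svecS i : svec i.+1 = gshift t0 (svec i).
Proof. by case: (in_family_gsigma (in_family_iter i)). Qed.

Lemma iter_gsigma_ser i : iter i (@gsigma_ser K) [:: t0] = [:: iter_sigma i].
Proof. by elim: i => //= i ->. Qed.

(** * The action of the module A on one solution *)

Section Module.
Variable r : nat.
Implicit Types g : 'rV[RF C]_r.

Definition avec g : gvec K := \sum_(i < r) tvec (rfmul iota0 (g 0 i) (iter_sigma i)).

Lemma Aact_coefE g k : ser_coef (Aact iota0 g [:: t0]) k =
  \sum_(i < r) term_coef (rfmul iota0 (g 0 i) (iter_sigma i)) k.
Proof.
rewrite /ser_coef /Aact big_flatten /= big_map -[RHS]big_enum.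
by apply: eq_bigr => i _; rewrite iter_gsigma_ser big_seq1.
Qed.

Lemma Aact_coef g l n : ser_coef (Aact iota0 g [:: t0]) (fam_key t0 l n) = avec g l n.
Proof. by rewrite Aact_coefE /avec gvec_sum. Qed.

Lemma Aact_coef_key g k : ser_coef (Aact iota0 g [:: t0]) k != 0 ->
  exists n, k = fam_key t0 (kl k) n.
Proof.
rewrite Aact_coefE => h.
have [i hi] : exists i, term_coef (rfmul iota0 (g 0 i) (iter_sigma i)) k != 0.
  apply: contrapT => no; case/eqP: h; apply: big1 => i _; apply/eqP/negPn/negP => hi.
  by apply: no; exists i.
have [[o [a [E _]]] _] := rfmul_fam (g 0 i) (in_family_iter i).
by move: hi; rewrite E; apply: term_coef_fam_key.
Qed.

Lemma bounded_avec g : bounded (avec g).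
Proof.
apply: bounded_sum => i; apply: bounded_tvec.
by case: (rfmul_fam (g 0 i) (in_family_iter i)).
Qed.

Lemma log_bounded_avec g : log_bounded (avec g).
Proof.
move=> l n dl; rewrite /avec gvec_sum big1 // => i _.
by rewrite log_bounded_tvec //; case: (rfmul_fam (g 0 i) (in_family_iter i)).
Qed.

Lemma avec_frac g q (p : 'I_r -> {poly C}) : q != 0 ->
  (forall i, rfpoly q * g 0 i = rfpoly (p i)) ->
  pact q (avec g) = \sum_(i < r) pact (p i) (svec i).
Proof.
move=> q0 h; rewrite /avec pact_sumr; apply: eq_bigr => i _.
by apply: rfmul_frac (h i) => //; apply: in_family_iter.
Qed.

Lemma common_denominator (g : 'I_r -> RF C) : exists q (p : 'I_r -> {poly C}), q != 0 /\
  forall i, rfpoly q * g i = rfpoly (p i).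
Proof.
exists (\prod_i rfden (g i)), (fun i => rfnum (g i) * \prod_(j | j != i) rfden (g j)).
split; first by apply/prodf_neq0 => i _; apply: rfden_neq0.
move=> i; rewrite (bigD1 i) //= !rfpolyM [X in _ * X = _]rfE.
have : rfpoly (rfden (g i)) != 0 by rewrite rfpoly_eq0 rfden_neq0.
by move=> h; rewrite mulrC mulrA divfK.
Qed.

Lemma avecD g g' : avec (g + g') = avec g + avec g'.
Proof.
have [q [p [q0 hp]]] := common_denominator (fun i => g 0 i).
have [q' [p' [q0' hp']]] := common_denominator (fun i => g' 0 i).
have qq0 : q * q' != 0 by rewrite mulf_neq0.
apply: (pact_inj (iota0 := iota0) (ltn0Sn _ : 0 < v)%N qq0);
  [exact: bounded_avec | by apply: bounded_add; apply: bounded_avec | ].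
rewrite (@avec_frac _ _ (fun i => p i * q' + q * p' i)) //; last first.
  by move=> i; rewrite mxE mulrDr rfpolyD !rfpolyM -hp -hp'; ring.
rewrite pactDr {1}mulrC !pactM (avec_frac q0 hp) (avec_frac q0' hp') !pact_sumr -big_split.
by apply: eq_bigr => i _; rewrite pactDl [p i * _]mulrC !pactM.
Qed.

Lemma avec_scale f q p g : q != 0 -> rfpoly q * f = rfpoly p ->
  pact q (avec (f *: g)) = pact p (avec g).
Proof.
move=> q0 qf; have [q' [p' [q0' hp]]] := common_denominator (fun i => g 0 i).
apply: (pact_inj (iota0 := iota0) (ltn0Sn _ : 0 < v)%N q0');
  try exact/bounded_pact/bounded_avec.
rewrite -pactM (@avec_frac _ _ (fun i => p * p' i)) ?mulf_neq0 //; last first.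
  by move=> i; rewrite mxE !rfpolyM -hp -qf; ring.
rewrite -pactM mulrC pactM (avec_frac q0' hp) pact_sumr.
by apply: eq_bigr => i _; rewrite pactM.
Qed.

Lemma avecN g : avec (- g) = - avec g.
Proof.
have := @avec_scale (-1) 1 (-1) g (oner_neq0 _).
rewrite rfpoly1 mul1r -[X in rfpoly X]sub0r rfpolyB rfpoly0 rfpoly1 sub0r => /(_ erefl).
by rewrite pact1 pactNl pact1 scaleN1r.
Qed.

Variable l : nat -> {poly C}.
Hypothesis lr : l r != 0.
Hypothesis t0_sol : ser_zero (Lact iota0 r l [:: t0]).

Lemma svec_rel : \sum_(j < r.+1) pact (l j) (svec j) = 0.
Proof.
apply/funext => m; apply/funext => n; have := t0_sol (fam_key t0 m n).
rewrite /ser_coef /Lact big_flatten big_map (_ : iota 0 r.+1 = index_iota 0 r.+1) //.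
rewrite big_mkord gvec_sum => h; rewrite -[RHS]h; apply: eq_bigr => j _.
rewrite iter_gsigma_ser big_seq1 -[RHS]/(tvec _ m n).
by rewrite -(@rfmul_frac (rfpoly (l j)) _ _ 1) ?oner_neq0 ?pact1 ?rfpoly1 ?mul1r //;
  apply: in_family_iter.
Qed.

(** [Ashift] reduces [S g] modulo [L]; as [L] annihilates [t0] by [svec_rel], the reduction does not
    change the action. *)
Lemma avec_shift g : avec (Ashift l g) = gshift t0 (avec g).
Proof.
have [r0|r_gt0] := posnP r.
  rewrite /avec !big1 ?gshift0 // => i; by have := ltn_ord i; rewrite {2}r0.
have [q [p [q0 hp]]] := common_denominator (fun i => g 0 i).
pose P (i : nat) := if insub i is Some j then p j else 0.
have PE (i : 'I_r) : P i = p i by rewrite /P insubT //= => h; congr p; apply: val_inj.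
have hP i : (i < r)%N -> rfpoly q * gcoord g i = rfpoly (P i).
  by move=> ir; rewrite /P /gcoord insubT hp.
pose tau : {poly C} := 'X + 1.
have tau0 : q \Po tau != 0 by rewrite comp_tau_eq0.
have hS i : (i < r)%N -> rfpoly (q \Po tau) * rfsigma (gcoord g i) = rfpoly (P i \Po tau).
  by move=> ir; rewrite -!rfsigma_poly -rfsigmaM hP.
(* [q \Po tau] clears the shifted coordinates of [g], and [l r] the division made by the
   reduction. *)
pose Q := (q \Po tau) * l r.
have Q0 : Q != 0 by rewrite mulf_neq0.
apply: (pact_inj (iota0 := iota0) (ltn0Sn _ : 0 < v)%N Q0);
  [exact: bounded_avec | exact/bounded_gshift/bounded_avec | ].
pose P' (i : nat) := (if i is i'.+1 then l r * (P i' \Po tau) else 0)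
                     - (P r.-1 \Po tau) * l i.
rewrite (@avec_frac _ _ (fun i => P' i)) //; last first.
  move=> i; rewrite mxE /P' /Q mulrBr rfpolyB; congr (_ - _).
    case: i => -[|i] ir /=; first by rewrite mulr0 rfpoly0.
    by rewrite !rfpolyM -hS 1?ltnW //; ring.
  rewrite !rfpolyM -hS ?prednK //.
  have aux (F : fieldType) (x y z w : F) : y != 0 -> x * y * (z * w / y) = x * z * w.
    by move=> y0; field.
  by apply: aux; rewrite rfpoly_eq0.
rewrite /Q [_ * l r]mulrC pactM -gshift_pact //; last exact: bounded_avec.
rewrite (avec_frac q0 hp) gshift_sum; last by move=> i; apply/bounded_pact/bounded_svec.
have -> : \sum_(i < r) gshift t0 (pact (p i) (svec i)) =
          \sum_(i < r) pact (P i \Po tau) (svec i.+1).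
  apply: eq_bigr => i _; rewrite gshift_pact //; last exact: bounded_svec.
  by rewrite svecS PE.
have S0 := svec_rel; rewrite big_ord_recr /= in S0.
transitivity (\sum_(i < r) pact (if (i : nat) is i'.+1 then l r * (P i' \Po tau) else 0) (svec i)
   - pact (P r.-1 \Po tau) (\sum_(i < r) pact (l i) (svec i))).
  rewrite pact_sumr -sumrB; apply: eq_bigr => i _.
  by rewrite /P' pactBl pactM.
(* The relation replaces minus the sum of the [l_i sigma^i] with [i < r] by [l_r sigma^r], the top
   term that the reduction had eliminated. *)
rewrite -pactNr (addr0_eq S0) -pactM -!(big_mkord xpredT (fun i =>
  pact (if i is i'.+1 then l r * (P i' \Po tau) else 0) (svec i))).
rewrite -(big_mkord xpredT (fun i => pact (P i \Po tau) (svec i.+1))).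
rewrite -[X in index_iota 0 X](prednK r_gt0) big_nat_recl // pact0l add0r.
rewrite -[in RHS](prednK r_gt0) big_nat_recr //= pactDr prednK // -!pactM [_ * l r]mulrC.
congr (_ + _); rewrite pact_sumr; apply: eq_bigr => i _; by rewrite pactM.
Qed.

End Module.
End Action.

(** * Leading terms of the difference operator *)

Section LeadingTerm.
Variable K : fieldType.
Hypothesis char0 : forall n, n.+1%:R != 0 :> K.
Variable t0 : gterm K.
Hypothesis t0_valid : gterm_valid t0.
Local Notation v := (vof t0).
Local Notation u := (gu t0).
Local Notation phi := (gphi t0).
Local Notation d := (gd t0).
Local Notation E := (psexp (expdiff t0) : fps K).
Local Notation B n := (stretch v (binser (- expo t0 n)) : fps K).

Lemma binser_coef1 (al : K) : binser al 1%N = al.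
Proof. by rewrite /binser big_ord1 factS fact0 divr1 subr0. Qed.

Lemma psexp0 (D : fps K) : psexp D 0%N = 1.
Proof. by rewrite /psexp big_ord1 pspowE fact0 divr1. Qed.

(** The powers [D ^+ k] with [k >= 2] start at order [2 N > i] or later. *)
Lemma psexp_low (D : fps K) N i : fps_low N D -> (0 < i <= N)%N -> psexp D i = D i.
Proof.
move=> lowD /andP[i0 iN]; case: i i0 iN => // i _ iN.
have -> : psexp D i.+1 = \sum_(k < i.+2) (D ^+ k) i.+1 / (k`!)%:R.
  by apply: eq_bigr => k _; rewrite pspowE.
rewrite 2!big_ord_recl expr0 fps_coef1 mul0r add0r !lift0 factS fact0 divr1 expr1.
rewrite big1 ?addr0 // => k _; rewrite !lift0.
rewrite (@fps_low_exp _ N _ k.+2 lowD) ?mul0r //.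
by rewrite !mulnS; move: (N * k)%N iN => a; lia.
Qed.

Lemma mulB_low n (a : fps K) i : (i < v)%N -> (B n * a) i = a i.
Proof.
move=> iv; rewrite fps_coefM big_ord_recl stretch_at0 // binser0 mul1r subn0.
rewrite big1 ?addr0 // => j _; rewrite stretch_low ?mul0r //.
by rewrite lift0 ltn0Sn (leq_ltn_trans _ iv) // ltn_ord.
Qed.

(** The series [log(1 + 1/x)] starts at [t^v]. *)
Lemma shiftker_log n k i : (0 < k)%N -> (i < v)%N -> shiftker t0 n k i = 0.
Proof.
move=> k0 iv; rewrite /shiftker -(addn0 i) mulrC.
have lowL : fps_low v (stretch v (logser K)).
  case=> [|j] jv; first by rewrite stretch_at0.
  by rewrite stretch_low.
have := @fps_low_mul _ (v * k) 0 _ (B n * E) (fps_low_exp (k := k) lowL).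
apply=> //; rewrite !addn0 (leq_trans iv) // leq_pmulr //.
Qed.

Lemma shiftker_nolog n : shiftker t0 n 0 = B n * E.
Proof. by rewrite /shiftker expr0 mulr1. Qed.

Lemma shiftker0 n : shiftker t0 n 0 0%N = 1.
Proof. by rewrite shiftker_nolog mulB_low // psexp0. Qed.

Variables (G : gvec K) (n1 : int) (m : nat).
Hypothesis bG : bounded_at n1 G.
Hypothesis Gm : G m n1 != 0.
Hypothesis Gtop : forall l, (m < l)%N -> G l n1 = 0.
Hypothesis md : (m <= d)%N.

(** Here [m] is the highest power of log at the bottom order [n1]. A higher power contributes only
    through a factor [log(1 + 1/x)], of order [v]; within [v] steps it then meets [G] at [n1], where
    its coefficient is zero. *)
Lemma gshift_top j : (j <= v)%N ->
  gshift t0 G m (n1 - u + j%:Z) =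
  phi * \sum_(i < j.+1) G m (n1 + j%:Z - i%:Z) * shiftker t0 (n1 + j%:Z - i%:Z) 0 i.
Proof.
move=> jv; rewrite (@gshiftE _ _ n1 j.+1) //; last by lia.
rewrite /shift_upto (_ : n1 - u + j%:Z + u = n1 + j%:Z); last by ring.
congr (_ * _); have md' : (m < d.+1)%N by [].
rewrite (bigD1 (Ordinal md')) //= binn mul1r subnn [X in _ + X]big1 ?addr0 // => l /eqP lm.
have [ml|lm'] := ltnP m l; last first.
  rewrite bin_small ?mul0r // ltn_neqAle lm' andbT.
  by apply/eqP => e; apply: lm; apply: val_inj.
rewrite big1 ?mulr0 // => i _; have [iv|vi] := ltnP i v.
  by rewrite shiftker_log ?subn_gt0 ?mulr0.
have -> : i = j :> nat by have := ltn_ord i; lia.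
by rewrite addrK Gtop ?mul0r.
Qed.

(** Each [x^(m/v)] changes by a series starting with [(m/v) x^(m/v - 1)], of order [v - m] in [t]; a
    constant does not change. *)
Lemma expdiff_low : (size (gp t0) <= v)%N ->
  fps_low (v - (size (gp t0)).-1) (expdiff t0).
Proof.
move=> pv n nlt; rewrite /expdiff big1 // => i _.
have [ip|pi] := ltnP i (size (gp t0)); last by rewrite nth_default ?mul0r.
have [ni0|ni0] := posnP (n + i).
  have i0 : i = 0%N :> nat by lia.
  by rewrite ni0 stretch_at0 // binser0 /ps1 eqxx subrr mulr0.
rewrite stretch_low ?ni0 /=; last by lia.
by rewrite /ps1 (gtn_eqF ni0) subr0 mulr0.
Qed.

(** The coefficient is [mu / v] times the leading coefficient of [gp t0], and [mu > 0] because the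
    constant term is zero. *)
Lemma expdiff_lead : (size (gp t0) <= v)%N -> (gp t0)`_0 = 0 -> gp t0 != 0 ->
  expdiff t0 (v - (size (gp t0)).-1)%N != 0.
Proof.
move=> pv p00 p0; set mu := (size (gp t0)).-1.
have lc : (gp t0)`_mu != 0 by rewrite -lead_coefE lead_coef_eq0.
have mu0 : (0 < mu)%N by rewrite lt0n; apply: contraNneq lc => ->; rewrite p00.
have muv : (mu < v)%N by rewrite /mu prednK // size_poly_gt0.
rewrite /expdiff (bigD1 (Ordinal muv)) //= subnK ?(ltnW muv) // stretch_at1 //.
rewrite binser_coef1 /ps1 /= subr0 big1 ?addr0.
  by rewrite !mulf_neq0 ?invr_neq0 ?(v_neq0 char0) // -(prednK mu0).
move=> i /eqP imu; have [ip|pi] := ltnP i (size (gp t0)); last by rewrite nth_default ?mul0r.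
have {}imu : (i < mu)%N.
  rewrite ltn_neqAle -ltnS prednK ?size_poly_gt0 // ip andbT.
  by apply/eqP => e; apply: imu; apply: val_inj.
have ni0 : (0 < v - mu + i)%N by lia.
rewrite stretch_low ?ni0 /=; last by lia.
by rewrite /ps1 (gtn_eqF ni0) subr0 mulr0.
Qed.

(* The four ways in which the leading term of [F(x+1) - F(x)] can arise: a change
   of order from Gamma, from phi <> 1, from the exponential, or the derivative
   of the power of x. *)
Lemma delta_lead_aux : expo t0 n1 != 0 ->
  exists2 n, n <= n1 + v%:Z & (gshift t0 G - G) m n != 0.
Proof.
move=> ex0; have [phi0 pv p00 _] := t0_valid.
have [u_neg|u_pos|u0] := ltgtP u 0.
(* The shift starts at [n1 - u > n1], so the leading term of [- G] survives. *)
- exists n1; first by rewrite lerDl.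
  by rewrite gvecB (bounded_gshift_at bG) ?sub0r ?oppr_eq0 //; lia.
(* The shift starts below [n1], where [G] vanishes. *)
- exists (n1 - u); first by lia.
  have := @gshift_top 0 isT; rewrite addr0 big_ord1 subr0 addr0 shiftker0 mulr1.
  by rewrite gvecB => ->; rewrite (bG m (n := n1 - u)) ?subr0 ?mulf_neq0 //; lia.
have top j : (j <= v)%N -> gshift t0 G m (n1 + j%:Z) =
    phi * \sum_(i < j.+1) G m (n1 + j%:Z - i%:Z) * shiftker t0 (n1 + j%:Z - i%:Z) 0 i.
  by move=> /gshift_top; rewrite u0 subr0.
have [phi1|phi1] := eqVneq phi 1; last first.
  exists n1; first by rewrite lerDl.
  have := top 0%N isT; rewrite addr0 big_ord1 subr0 shiftker0 mulr1 gvecB => ->.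
  by rewrite -{2}[G m n1]mul1r -mulrBl mulf_neq0 // subr_eq0.
(* The summand [i = 0] cancels against [G], those with [0 < i < j] vanish since neither [B] nor [E]
   has such a coefficient, and [i = j] remains. *)
have low j : (0 < j <= v)%N -> (forall i, (0 < i < j)%N -> E i = 0) ->
    (gshift t0 G - G) m (n1 + j%:Z) = G m n1 * shiftker t0 n1 0 j.
  move=> /andP[j0 jv] Elow; rewrite gvecB top // phi1 mul1r.
  rewrite big_ord_recl subr0 shiftker0 mulr1 addrC addKr.
  case: j j0 jv Elow => // j _ jv Elow.
  rewrite big_ord_recr /= big1 ?add0r => [|i _].
    by rewrite /bump leq0n add1n addrK.
  have ij : (i.+1 < j.+1)%N by rewrite ltnS ltn_ord.
  rewrite /bump leq0n add1n shiftker_nolog mulB_low ?Elow ?mulr0 //.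
  exact: leq_trans jv.
have [p0|p0] := eqVneq (gp t0) 0.
  have E1 : E = 1.
    have D0 : expdiff t0 = 0.
      by apply/funext => n; rewrite /expdiff big1 // => i _; rewrite p0 coef0 mul0r.
    rewrite D0; apply/funext => n; rewrite fps_coef1; case: n => [|n]; first exact: psexp0.
    by rewrite (@psexp_low _ n.+1) // ltnSn.
  (* Without exponential part the first new coefficient is that of [1/x] in [(1 + 1/x)^(-s)], namely
     [- s], nonzero by [ex0]. *)
  exists (n1 + v%:Z) => //.
  rewrite low ?ltn0Sn ?leqnn // => [|i]; last by rewrite E1 fps_coef1; case: i.
  rewrite shiftker_nolog E1 mulr1 stretch_at1 // binser_coef1.
  by rewrite mulf_neq0 // oppr_eq0.
set j := (v - (size (gp t0)).-1)%N.
have lowD := expdiff_low pv; have Dj := expdiff_lead pv p00 p0.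
have szp : (1 < size (gp t0))%N.
  rewrite ltnNge; apply: contra p0 => /size1_polyC ->; by rewrite p00.
exists (n1 + j%:Z); first by rewrite lerD2l /j; lia.
have jv : (0 < j < v)%N by move: szp pv; rewrite /j; move: (size _) => s; lia.
rewrite low; last 2 first.
- by move: jv; lia.
- move=> i /andP[i0 ij]; rewrite (psexp_low lowD) ?lowD // i0 ltnW //.
case/andP: jv => j0 jv.
by rewrite shiftker_nolog mulB_low // (psexp_low lowD) ?j0 ?leqnn // mulf_neq0.
Qed.

End LeadingTerm.

Lemma delta_lead (K : fieldType) (char0 : forall n, n.+1%:R != 0 :> K) (t0 : gterm K)
    (G : gvec K) (n1 : int) (l1 : nat) :
  gterm_valid t0 -> bounded_at n1 G -> log_bounded t0 G -> G l1 n1 != 0 ->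
  expo t0 n1 != 0 ->
  exists l n, n <= n1 + (vof t0)%:Z /\ (gshift t0 G - G) l n != 0.
Proof.
move=> tv bG lG G1 ex0.
have exG : exists l, G l n1 != 0 by exists l1.
have ub l : G l n1 != 0 -> (l <= gd t0)%N.
  by apply: contraR; rewrite -ltnNge => /lG ->.
case: (ex_maxnP exG ub) => m Gm mmax.
have Gtop l : (m < l)%N -> G l n1 = 0.
  by move=> ml; apply/eqP; apply: contraTT ml => /mmax; rewrite -leqNgt.
have [n nle H] := delta_lead_aux char0 tv bG Gm Gtop (ub _ Gm) ex0.
by exists m, n.
Qed.

(** * Integrality *)

Section Integrality.
Variables (C K : fieldType) (iota0 : {rmorphism C -> K}).
Hypothesis char0 : forall n, n.+1%:R != 0 :> K.
Variables (Rr : realType) (iv : K -> Rr).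
Hypothesis iv_ratadd : forall (m : rat) (s : K), iv (ratr m + s) = iv (ratr m) + iv s.
Hypothesis iv_rat : forall m : rat, iv (ratr m) = ratr m.
Variable t0 : gterm K.
Hypothesis t0_valid : gterm_valid t0.
Variables (r : nat) (l : nat -> {poly C}).
Hypothesis lr : l r != 0.
Hypothesis t0_sol : ser_zero (Lact iota0 r l [:: t0]).
Local Notation v := (vof t0).
Local Notation avec := (avec iota0 t0).
Implicit Types g : 'rV[RF C]_r.

Lemma ratr_frac_char0 (n : int) (k : nat) : ratr (n%:~R / k.+1%:R) = n%:~R / k.+1%:R :> K.
Proof.
set q := _ / _; have q0 : (denq q)%:~R != 0 :> K.
  by rewrite intr_eq0_char0 ?denq_neq0.
rewrite /ratr; apply/eqP; rewrite eqr_div ?char0 //.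
have : (numq q)%:~R * k.+1%:R = n%:~R * (denq q)%:~R :> rat.
  apply/eqP; rewrite -eqr_div ?intr_eq0 ?denq_neq0 ?pnatr_eq0 //.
  by rewrite divq_num_den /q.
rewrite !pmulrn -!intrM => /intr_inj ->.
by rewrite intrM.
Qed.

Definition weight (n : int) : Rr := iv (expo t0 n).

Lemma weightE n : weight n = iv (gs t0) + n%:~R / v%:R.
Proof.
rewrite /weight /expo addrC -ratr_frac_char0 iv_ratadd iv_rat addrC.
by rewrite fmorph_div /= ratr_int ratr_nat.
Qed.

Lemma weight_le m n : m <= n -> weight m <= weight n.
Proof. by move=> mn; rewrite !weightE lerD2l ler_pM2r ?invr_gt0 ?ltr0n // ler_int. Qed.

Lemma weight_shift n k : weight (n + (v * k)%:Z) = weight n + k%:R.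
Proof.
rewrite !weightE rmorphD /= -pmulrn natrM mulrDl addrA; congr (_ + _).
by rewrite mulrAC divff ?mul1r // pnatr_eq0.
Qed.

Lemma weight_nat n k : expo t0 n = k%:R -> weight n = k%:R.
Proof.
move=> e; rewrite /weight e.
have -> : k%:R = ratr (k%:R) :> K.
  have := ratr_frac_char0 k%:Z 0; rewrite !divr1 -!pmulrn.
  by move->.
by rewrite iv_rat ratr_nat.
Qed.

Lemma Aact_integralE g : ser_integral iv (Aact iota0 g [:: t0]) <->
  forall m n, avec g m n != 0 -> 0 <= weight n.
Proof.
split=> [h m n gn|h k hk].
  by apply: (h (fam_key t0 m n)); rewrite Aact_coef.
have [n kE] := Aact_coef_key char0 t0_valid hk.
by move: hk; rewrite kE Aact_coef => /h.
Qed.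

Lemma Aact_integral0 : ser_integral iv (Aact iota0 (0 : 'rV_r) [:: t0]).
Proof.
apply/Aact_integralE => m n; have -> : avec (0 : 'rV_r) = 0; last by rewrite gvec0 eqxx.
apply: (addrI (avec (0 : 'rV_r))).
by rewrite -(avecD iota0 char0 t0_valid) !addr0.
Qed.

Lemma Aact_integralD g g' : ser_integral iv (Aact iota0 g [:: t0]) ->
  ser_integral iv (Aact iota0 g' [:: t0]) ->
  ser_integral iv (Aact iota0 (g + g') [:: t0]).
Proof.
move=> /Aact_integralE h /Aact_integralE h'; apply/Aact_integralE => m n.
rewrite (avecD iota0 char0 t0_valid) gvecD => gn.
have [e|/h //] := eqVneq (avec g m n) 0.
by apply: (h' m); rewrite e add0r in gn.
Qed.

(** With [c = p/q], the lowest coefficient of [c g] reappears, times the leading coefficient of [q],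
    in [q c g = p g]. It stems from a coefficient of [g] at no larger index, because
    [deg p <= deg q]. *)
Lemma Aact_integralZ c g : c \in @rf_inf C -> ser_integral iv (Aact iota0 g [:: t0]) ->
  ser_integral iv (Aact iota0 (c *: g) [:: t0]).
Proof.
have [p [q [q0 ->]]] := rffracP c; rewrite rf_inf_frac // => pq /Aact_integralE h.
apply/Aact_integralE => m n.
have qc : rfpoly q * (rfpoly p / rfpoly q) = rfpoly p :> RF C.
  by rewrite mulrC divfK // rfpoly_eq0.
have e := avec_scale iota0 char0 t0_valid g q0 qc.
move=> /(bounded_min (bounded_avec iota0 char0 t0_valid _))[n0 [l0 [n0n Gn0 bG]]].
have := pact_lead iota0 (ltn0Sn _ : 0 < v)%N q l0 bG; rewrite e => eL.
have : pact iota0 v p (avec g) l0 (n0 - (v * (size q).-1)%:Z) != 0.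
  by rewrite eL mulf_neq0 // fmorph_eq0 lead_coef_eq0.
rewrite /pact => S0.
have [i Fi] : exists i : 'I_(size p),
    avec g l0 (n0 - (v * (size q).-1)%:Z + (v * i)%:Z) != 0.
  apply: contrapT => no; case/eqP: S0; apply: big1 => i _; apply/eqP.
  rewrite mulf_eq0; apply/orP; right; apply/negPn/negP => hi.
  by apply: no; exists i.
apply: le_trans (h _ _ Fi) _; apply: weight_le; apply: le_trans n0n.
have : (v * i <= v * (size q).-1)%N.
  rewrite leq_mul2l; apply/orP; right.
  by move: (ltn_ord i) pq; move: (size p) (size q) (nat_of_ord i) => a b x; clear; lia.
by move: (v * i)%N (v * _)%N => a b ab; clear -ab; lia.
Qed.

(** If the order [n0] of [g] had weight below 1, [delta_lead] applied to [x^(k+1) g] would produce a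
    coefficient of negative weight in the element assumed integral. *)
Lemma Aact_integral_delta k g :
  ser_integral iv (Aact iota0
    ((rfX C / (rfX C) ^+ k) *: Adelta l ((rfX C) ^+ k.+1 *: g)) [:: t0]) ->
  ser_integral iv (Aact iota0 (rfX C *: g) [:: t0]).
Proof.
move=> /Aact_integralE h; apply/Aact_integralE => m n.
have Xn (i : nat) : 'X^i != 0 :> {poly C} by rewrite -size_poly_eq0 size_polyXn.
have scaleXn i g' : avec ((rfX C) ^+ i *: g') = pact iota0 v 'X^i (avec g').
  rewrite -[LHS](pact1 iota0 v); apply: (avec_scale iota0 char0 t0_valid _ (oner_neq0 _)).
  by rewrite rfpoly1 mul1r rfpolyXn.
have bF := bounded_avec iota0 char0 t0_valid g.
rewrite -[rfX C]expr1 scaleXn pactXn muln1 => Fn; rewrite leNgt; apply/negP => wn.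
have [n0 [l0 [n0n Fn0 bn0]]] := bounded_min bF Fn.
have wn0 : weight n0 < 1.
  apply: le_lt_trans (weight_le n0n) _.
  by rewrite -[v]muln1 weight_shift gtrDr.
pose n1 := n0 - (v * k.+1)%:Z.
pose G := avec ((rfX C) ^+ k.+1 *: g).
have GE l' n' : G l' n' = avec g l' (n' + (v * k.+1)%:Z) by rewrite /G scaleXn pactXn.
have bG : bounded_at n1 G.
  by move=> l' n' nn1; rewrite GE bn0 // -ltrBrDr.
have G0 : G l0 n1 != 0 by rewrite GE /n1 subrK.
(* A zero exponent at [n1] would give [n0 = n1 + v (k + 1)] the weight [k + 1 >= 1]. *)
have ex0 : expo t0 n1 != 0.
  apply/eqP => e; have e' := @weight_nat n1 0 e.
  have := weight_shift n1 k.+1; rewrite e' add0r /n1 subrK => w.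
  by move: wn0; rewrite w ltNge ler1n.
have [l' [n' [n'le Hn']]] := delta_lead char0 t0_valid bG
  (log_bounded_avec iota0 char0 t0_valid _) G0 ex0.
have He : avec (Adelta l ((rfX C) ^+ k.+1 *: g)) = gshift t0 G - G.
  by rewrite /Adelta (avecD iota0 char0 t0_valid) (avecN iota0 char0 t0_valid)
     (avec_shift char0 t0_valid lr t0_sol).
set g' := Adelta _ _ in h He.
have xk : rfpoly 'X^k * (rfX C / (rfX C) ^+ k) = rfpoly 'X.
  by rewrite rfpolyXn mulrC divfK // expf_neq0 // rfX_neq0.
have := avec_scale iota0 char0 t0_valid g' (Xn k) xk.
rewrite He -['X in RHS]expr1.
move=> /(congr1 (fun F : gvec K => F l' (n' - v%:Z))).
rewrite !pactXn muln1 subrK => e.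
(* The factor [x^(1 - k)] moves index [n'] to [n' - v + v k <= n0 - v], whose weight is negative. *)
have w_ge0 : 0 <= weight (n' - v%:Z + (v * k)%:Z) by apply: (h l'); rewrite e.
have w_le : weight (n' - v%:Z + (v * k)%:Z) <= weight (n0 - v%:Z).
  apply: weight_le; move: n'le; rewrite /n1 mulnS.
  by move: (v * k)%N => A le1; clear -le1; lia.
move: wn0; rewrite -[n0](subrK v%:Z) -[v in _ + v%:Z]muln1 weight_shift.
by rewrite ltNge lerDr (le_trans w_ge0 w_le).
Qed.

End Integrality.

(** * Solving the linear system *)

Section LinearSystem.
Variables (C : fieldType) (r : nat) (l : nat -> {poly C}).
Implicit Types (c : 'I_r -> RF C) (g : 'rV[RF C]_r).
Local Notation X := (rfX C).
Local Notation inf := (@rf_inf C).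

Lemma gcoordD g g' n : gcoord (g + g') n = gcoord g n + gcoord g' n.
Proof. by rewrite /gcoord; case: insubP => [i _ _|_]; rewrite ?mxE ?addr0. Qed.

Lemma gcoordZ a g n : gcoord (a *: g) n = a * gcoord g n.
Proof. by rewrite /gcoord; case: insubP => [i _ _|_]; rewrite ?mxE ?mulr0. Qed.

Lemma AshiftD g g' : Ashift l (g + g') = Ashift l g + Ashift l g'.
Proof.
apply/rowP => i; rewrite !mxE !gcoordD rfsigmaD.
case: (nat_of_ord i) => [|i']; rewrite ?gcoordD ?rfsigmaD !mulrDl; ring.
Qed.

Lemma AshiftZ a g : Ashift l (a *: g) = rfsigma a *: Ashift l g.
Proof.
apply/rowP => i; rewrite !mxE !gcoordZ rfsigmaM.
by case: (nat_of_ord i) => [|i']; rewrite ?gcoordZ ?rfsigmaM mulrBr ?mulr0 !mulrA.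
Qed.

Lemma AdeltaD g g' : Adelta l (g + g') = Adelta l g + Adelta l g'.
Proof. by rewrite /Adelta AshiftD opprD addrACA. Qed.

Lemma Adelta0 : Adelta l (0 : 'rV[RF C]_r) = 0.
Proof. by apply: (addrI (Adelta l 0)); rewrite -AdeltaD !addr0. Qed.

Lemma Adelta_sum (F : 'I_r -> 'rV[RF C]_r) : Adelta l (\sum_i F i) = \sum_i Adelta l (F i).
Proof.
by elim/big_rec2: _ => [|i x y _ <-]; [exact: Adelta0 | exact: AdeltaD].
Qed.

(** The product rule for [Delta]; its second summand is the error that [rf_inf_delta] controls. *)
Lemma AdeltaZ a g : Adelta l (a *: g) = rfsigma a *: Adelta l g + (rfsigma a - a) *: g.
Proof. by rewrite /Adelta AshiftZ scalerBr scalerBl addrA subrK. Qed.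

(** Integrality is kept abstract: it enters through closure under C(x)_oo-combinations, the basis
    [W] and the estimate [Int_delta]. *)
Variable Int : 'rV[RF C]_r -> Prop.
Hypothesis Int0 : Int 0.
Hypothesis IntD : forall g g', Int g -> Int g' -> Int (g + g').
Hypothesis IntZ : forall a g, a \in inf -> Int g -> Int (a *: g).
Variable W : 'I_r -> 'rV[RF C]_r.
Hypothesis W_int : forall i, Int (W i).
Hypothesis W_span : forall f, Int f ->
  exists c, (forall i, c i \in inf) /\ f = \sum_(i < r) c i *: W i.
Hypothesis W_free : forall c, (forall i, c i \in inf) ->
  \sum_(i < r) c i *: W i = 0 -> forall i, c i = 0.
Variable k : nat.
Hypothesis Int_delta : forall g,
  Int ((X / X ^+ k) *: Adelta l (X ^+ k.+1 *: g)) -> Int (X *: g).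

Lemma Int_comb c : (forall i, c i \in inf) -> Int (\sum_i c i *: W i).
Proof.
move=> ci; elim/big_rec: _ => [|i g _ hg]; first exact: Int0.
by apply: IntD hg; apply: IntZ.
Qed.

Lemma common_exponent c : exists n, forall i, X ^- n * c i \in inf.
Proof.
have [e he] : exists e : 'I_r -> nat, forall i m, (e i <= m)%N -> X ^- m * c i \in inf.
  have /choice[e he] : forall i, exists n, forall m, (n <= m)%N -> X ^- m * c i \in inf.
    by move=> i; apply: rf_inf_exprN_mul.
  by exists e.
exists (\max_i e i)%N => i; apply: he.
exact: (leq_bigmax i).
Qed.

Lemma W_free_rat c : \sum_(i < r) c i *: W i = 0 -> forall i, c i = 0.
Proof.
move=> cW i; have [n hn] := common_exponent c.
have h : \sum_(i < r) (X ^- n * c i) *: W i = 0.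
  transitivity (X ^- n *: \sum_(i < r) c i *: W i); last by rewrite cW scaler0.
  by rewrite scaler_sumr; apply: eq_bigr => j _; rewrite scalerA.
have /eqP := W_free hn h i; rewrite mulf_eq0 invr_eq0 expf_eq0 (negPf (rfX_neq0 C)) andbF.
by move/eqP.
Qed.

Lemma Int_coef c : Int (\sum_i c i *: W i) -> forall i, c i \in inf.
Proof.
move=> /W_span[c' [ci e]] i.
have h : \sum_(i < r) (c i - c' i) *: W i = 0.
  apply/eqP; rewrite -[X in X == _](_ : \sum_i c i *: W i - \sum_i c' i *: W i = _).
    by rewrite e subrr.
  by rewrite -sumrB; apply: eq_bigr => j _; rewrite scalerBl.
by have /eqP := W_free_rat h i; rewrite subr_eq0 => /eqP ->.
Qed.

(** This is [psi_i] of the theorem without its factor [x^(-lam - 1)]. *)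
Let H i := X ^- k *: Adelta l (X ^+ k.+1 *: W i).

Lemma Int_H_coef c : Int (\sum_i c i *: H i) -> forall i, c i \in inf.
Proof.
move=> hc; pose P n := [forall i, X ^- n * c i \in inf].
have exP : exists n, P n by have [n hn] := common_exponent c; exists n; apply/forallP.
case: (ex_minnP exP) => -[|n] /forallP hn nmin.
  by move=> i; have := hn i; rewrite expr0 invr1 mul1r.
(* All [X^(-n-1) c_i] lie in C(x)_oo, but by minimality [X^(-n) c_i0] does not: [e_i0] below does
   not vanish at infinity. *)
have /forallPn[i0 hi0] : ~~ P n by apply/negP => /nmin; rewrite ltnn.
pose e i := X ^- n.+1 * c i.
have /choice[b hb] : forall i, exists f, rfsigma f = e i by move=> i; apply: rfsigma_surj.
have bi i : b i \in inf by rewrite -rf_inf_sigma hb; apply: hn.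
have X0 := rfX_neq0 C.
have Xe i : X * e i = X ^- n * c i.
  by rewrite /e exprS invfM !mulrA divff // mul1r.
pose f := \sum_i b i *: W i.
(* The product rule leaves the given integral combination, divided by [X^n], and an error with
   coefficients in C(x)_oo. *)
have hf : (X / X ^+ k) *: Adelta l (X ^+ k.+1 *: f) =
    X ^- n *: (\sum_i c i *: H i) + \sum_i (X ^+ 2 * (rfsigma (b i) - b i)) *: W i.
  rewrite /f !scaler_sumr Adelta_sum scaler_sumr -big_split; apply: eq_bigr => i _ /=.
  rewrite scalerA [X ^+ k.+1 * _]mulrC -[(b i * _) *: _]scalerA AdeltaZ hb scalerDr.
  congr (_ + _).
    by rewrite /H !scalerA mulrAC Xe.
  rewrite !scalerA; congr (_ *: _).
  have aux (F : fieldType) (x y z : F) : y != 0 -> x / y * z * (x * y) = x ^+ 2 * z.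
    by move=> y0; field.
  by rewrite exprS; apply: aux; rewrite expf_neq0.
have : Int (X *: f).
  apply: Int_delta; rewrite hf; apply: IntD.
    by apply: IntZ hc; apply: rf_inf_exprN.
  by apply: Int_comb => i; apply: rf_inf_delta.
have -> : X *: f = \sum_i (X * b i) *: W i.
  by rewrite /f scaler_sumr; apply: eq_bigr => i _; rewrite scalerA.
(* Shifting [X b_i0] gives [(X + 1) e_i0]. As [X / (X + 1)] lies in C(x)_oo, so does
   [X e_i0 = X^(-n) c_i0], contrary to the choice of [i0]. *)
move=> /Int_coef/(_ i0); rewrite -rf_inf_sigma rfsigmaM hb rfsigmaX => hX.
case/negP: hi0; rewrite -Xe.
have X10 : X + 1 != 0.
  by rewrite -rfpoly1 -rfpolyD rfpoly_eq0 -size_poly_eq0 size_tau.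
have -> : X * e i0 = X / (X + 1) * ((X + 1) * e i0) by rewrite mulrA divfK.
apply: rf_infM hX; rewrite -rfpoly1 -rfpolyD rf_inf_frac; last first.
  by rewrite -size_poly_eq0 size_tau.
by rewrite size_tau size_polyX.
Qed.

Lemma solve_system a : (forall i, a i \in inf) ->
  exists bb, (forall i, bb i \in inf) /\
    \sum_(i < r) a i *: W i = \sum_(i < r) rfsigma (bb i) *: H i.
Proof.
move=> ha; pose N : 'M[RF C]_r := \matrix_i H i.
have rowN (c : 'rV[RF C]_r) : c *m N = \sum_i c 0 i *: H i.
  by rewrite mulmx_sum_row; apply: eq_bigr => i _; rewrite rowK.
have N_free : row_free N.
  rewrite -kermx_eq0; apply/eqP/row_matrixP => i; rewrite row0.
  set c := row i _; have cN : c *m N = 0 by rewrite /c -row_mul mulmx_ker row0.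
  (* All multiples of a kernel vector by [X^n] have coordinates in C(x)_oo, which forces the vector
     to be zero. *)
  apply/rowP => j; rewrite [RHS]mxE; apply: rf_inf_expr_eq0 => n.
  apply: (@Int_H_coef (fun j => X ^+ n * c 0 j)).
  rewrite (_ : \sum_i _ = X ^+ n *: (c *m N)); first by rewrite cN scaler0.
  by rewrite rowN scaler_sumr; apply: eq_bigr => i' _; rewrite -scalerA.
have N_unit : N \in unitmx by rewrite -row_free_unit.
pose c := (\sum_i a i *: W i) *m invmx N.
have cE : \sum_i a i *: W i = \sum_i c 0 i *: H i by rewrite -rowN mulmxKV.
(* Second use of [Int_H_coef]: the left-hand side is integral, so the solution is bounded at
   infinity. *)
have ci : forall i, c 0 i \in inf by apply: Int_H_coef; rewrite -cE; apply: Int_comb.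
have /choice[bb hbb] : forall i, exists f, rfsigma f = c 0 i.
  by move=> i; apply: rfsigma_surj.
exists bb; split=> [i|]; first by rewrite -rf_inf_sigma hbb.
by rewrite cE; apply: eq_bigr => i _; rewrite hbb.
Qed.

End LinearSystem.

(** * The theorem, with integrality tested on all basis solutions *)

Unset Implicit Arguments.
Set Strict Implicit.
Set Printing Implicit Defensive.

Theorem mainTheorem12
  (C : fieldType) (charC0 : [pchar C] =i pred0)
  (K : closedFieldType) (iota0 : {rmorphism C -> K})
  (Kalg : forall z : K, exists p : {poly C}, p != 0 /\ root (map_poly iota0 p) z)
  (Rr : realType) (iv : K -> Rr)
  (iv_add : forall s1 s2 : K, iv s1 + iv s2 <= iv (s1 + s2))
  (iv_ratadd : forall (m : rat) (s : K), iv (ratr m + s) = iv (ratr m) + iv s)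
  (iv_rat : forall m : rat, iv (ratr m) = ratr m)
  (r : nat) (l : nat -> {poly C}) (l0 : l 0%N != 0) (lr : l r != 0)
  (b : 'I_r -> gterm K)
  (b_valid : forall i, gterm_valid (b i))
  (b_sol : forall i, ser_zero (Lact iota0 r l [:: b i]))
  (b_free : forall c : 'I_r -> K,
      ser_zero [seq gscale (c i) (b i) | i <- enum 'I_r] -> forall i, c i = 0)
  (b_span : forall F : gseries K, gseries_valid F -> ser_zero (Lact iota0 r l F) ->
      exists c : 'I_r -> K, ser_eq F [seq gscale (c i) (b i) | i <- enum 'I_r])
  (W : 'I_r -> 'rV[RF C]_r)
  (W_int : forall i j, ser_integral iv (Aact iota0 (W i) [:: b j]))
  (W_span : forall f : 'rV[RF C]_r,
      (forall j, ser_integral iv (Aact iota0 f [:: b j])) ->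
      exists c : 'I_r -> RF C, (forall i, c i \in rf_inf (C:=C)) /\
                               f = \sum_(i < r) c i *: W i)
  (W_free : forall c : 'I_r -> RF C, (forall i, c i \in rf_inf (C:=C)) ->
      \sum_(i < r) c i *: W i = 0 -> forall i, c i = 0)
  (lam : int) (M : 'M[RF C]_r)
  (M_inf : forall i j, M i j \in rf_inf (C:=C))
  (hM : forall i, Adelta l (W i) = (rfX C ^ lam) *: \sum_(j < r) M i j *: W j)
  (lam_min : forall (lam' : int) (M' : 'M[RF C]_r),
      (forall i j, M' i j \in rf_inf (C:=C)) ->
      (forall i, Adelta l (W i) = (rfX C ^ lam') *: \sum_(j < r) M' i j *: W j) ->
      lam <= lam')
  (lam_ge : -1 <= lam)
  (k : nat) :
  let psi := fun i : 'I_r =>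
      (rfX C ^ (- (k%:Z) - lam - 1)) *: Adelta l ((rfX C ^+ k.+1) *: W i) in
  forall a : 'I_r -> RF C, (forall i, a i \in rf_inf (C:=C)) ->
  exists bb : 'I_r -> RF C, (forall i, bb i \in rf_inf (C:=C)) /\
    \sum_(i < r) (rfX C ^ (- lam - 1) * a i) *: W i
    = \sum_(i < r) rfsigma (bb i) *: psi i.
Proof.
have char0K n : n.+1%:R != 0 :> K.
  rewrite -(rmorph_nat iota0) fmorph_eq0.
  by have /pcharf0P -> := charC0.
(* Every hypothesis on [Int] holds for each basis solution separately, hence for all of them
   together. *)
pose Int (g : 'rV[RF C]_r) := forall j, ser_integral iv (Aact iota0 g [:: b j]).
move=> psi a ha.
have [] := @solve_system C r l Int _ _ _ W _ W_span W_free k _ a ha.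
- by move=> j; apply: (Aact_integral0 char0K iv (b_valid j)).
- by move=> g g' hg hg' j; apply: (Aact_integralD char0K (b_valid j) (hg j) (hg' j)).
- by move=> c g hc hg j; apply: (Aact_integralZ char0K iv_ratadd iv_rat (b_valid j) hc (hg j)).
- by move=> i j; apply: W_int.
- move=> g hg j.
  by apply: (Aact_integral_delta char0K iv_ratadd iv_rat (b_valid j) lr (b_sol j) (hg j)).
move=> bb [hbb e]; exists bb; split=> //.
(* Multiplying the solved system by [x^(-lam - 1)] turns the [H_i] into the [psi_i]. *)
have X0 := rfX_neq0 C.
transitivity (rfX C ^ (- lam - 1) *: \sum_(i < r) a i *: W i).
  by rewrite scaler_sumr; apply: eq_bigr => i _; rewrite scalerA.
rewrite e scaler_sumr; apply: eq_bigr => i _.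
rewrite /psi !scalerA; congr (_ *: _).
have -> : - k%:Z - lam - 1 = (- lam - 1) - k%:Z by ring.
have -> : rfX C ^ (- lam - 1 - k%:Z) = rfX C ^ (- lam - 1) * rfX C ^- k.
  by rewrite (expfzDr _ (- k%:Z)) // -exprnN.
move: (rfX C ^ _) (rfsigma _) (rfX C ^- k) => y z w.
by rewrite [z * (y * w)]mulrA [z * y]mulrC.
Qed.
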